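(* Let $Y_1,\ldots,Y_m$ be independent standard Pareto variables, $\Pr(Y_i>y)=y^{-1}$ for $y\ge1$, and let $\boldsymbol w=(w_1,\dots,w_m)$ be a fixed simplex weight vector. Then, as $t\to\infty$, $$\Pr\!\left(\sum_{i=1}^m w_iY_i>t\right)=\frac1t+2\sum_{i<j}w_iw_j\,\frac{\log t}{t^2}+O(t^{-2}).$$ For $m=2$ and $w_1,w_2>0$, the following identity is exact for $t>w_1+w_2$: $$\Pr(w_1Y_1+w_2Y_2>t)=\frac{w_1+w_2}{t}+\frac{w_1w_2}{t^2}\log\frac{(t-w_1)(t-w_2)}{w_1w_2};$$ if one of the two weights is zero, the probability is given by the corresponding one-dimensional Pareto identity. If $H_1,\dots,H_m$ are independent standard positive Half-Cauchy variables and $c=2/\pi$, then $$\Pr\!\left(\sum_{i=1}^m w_iH_i>t\right)=\frac ct+2c^2\sum_{i<j}w_iw_j\,\frac{\log t}{t^2}+O(t^{-2}).$$ Consequently, in these expansions the rate $(\log t)/t^2$ of the correction to the leading term cannot in general (i.e. for all $m$ and all $\boldsymbol w$) be improved to $O(t^{-2})$.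
   Context: A simplex weight vector satisfies $w_i\ge0$ and $\sum_{i=1}^m w_i=1$; $m\ge1$ is fixed. A standard positive Half-Cauchy variable $H$ has $\Pr(H>x)=\frac2\pi\arctan(1/x)$ for $x>0$. *)

(* Defs.v *)
From HB Require Import structures.
From mathcomp Require Import all_boot all_order all_algebra.
From mathcomp Require Import all_classical all_reals all_analysis.

Set Implicit Arguments.
Unset Strict Implicit.
Unset Printing Implicit Defensive.
Import Order.TTheory GRing.Theory Num.Theory.
Import numFieldNormedType.Exports.
Local Open Scope classical_set_scope.
Local Open Scope ring_scope.

Definition simplex_weights (R : realType) (m : nat) (w : 'I_m -> R) : Prop :=
  (forall i, 0 <= w i) /\ \sum_(i < m) w i = 1.

(* Mutual independence: the product rule holds along every subfamily. *)
Definition independent_RVs (R : realType) (d : measure_display)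
    (Omega : measurableType d) (P : probability Omega R) (I : finType)
    (X : I -> {RV P >-> R}) : Prop :=
  forall (J : {set I}) (B : I -> set R), (forall i, measurable (B i)) ->
    P [set omega | forall i, i \in J -> B i (X i omega)] =
    (\prod_(i in J) P (X i @^-1` B i))%E.

(* ccdf X x is Pr(X > x).  In both definitions below the prescribed values   *)
(* tend to 1 at the left end of the support, so the law is determined; in    *)
(* particular X >= 1, respectively X > 0, almost surely.                     *)
Definition standard_pareto (R : realType) (d : measure_display)
    (Omega : measurableType d) (P : probability Omega R)
    (X : {RV P >-> R}) : Prop :=
  forall y : R, 1 <= y -> ccdf X y = (y^-1)%:E.

Definition standard_half_cauchy (R : realType) (d : measure_display)
    (Omega : measurableType d) (P : probability Omega R)
    (X : {RV P >-> R}) : Prop :=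
  forall x : R, 0 < x -> ccdf X x = (2 / pi * atan (1 / x))%:E.

(* Lets the Landau notations be used with the filter +oo. *)
Canonical pinfty_filter_on (R : numFieldType) :=
  FilterType (pinfty_nbhs R) filter_filter.

(* Main.v *)
Require Import Defs.
From HB Require Import structures.
From mathcomp Require Import all_boot all_order all_algebra.
From mathcomp Require Import all_classical all_reals all_analysis.
From mathcomp Require Import measurable_realfun.
From mathcomp Require Import ring lra.

Set Implicit Arguments.
Unset Strict Implicit.
Unset Printing Implicit Defensive.
Import Order.TTheory GRing.Theory Num.Theory.
Import numFieldNormedType.Exports.
Local Open Scope classical_set_scope.
Local Open Scope ring_scope.

(** All asymptotics follow from one closure property. Say that a nonnegative
    variable has expansion (a, b) if Pr(X > x) = a / x + b ln x / x^2 + O(x^-2).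
    If X and Y are independent with expansions (a, b) and (a', b'), then X + Y
    has expansion (a + a', b + b' + 2 a a'): for N close to t / 2, the event
    X + Y > t is, up to an event of probability O(t^-2), the disjoint union of
    {Y <= N, X > t - Y} and {X <= N, Y > t - X}. Cutting the values of Y into
    unit intervals, the first event has probability
    sum_(n < N) Pr(n < Y <= n + 1) Pr(X > t - n) + O(t^-2), and expanding
    a / (t - n) = a / t + a n / t^2 + O(n^2 / t^3) leaves the truncated mean
    sum_n n Pr(n < Y <= n + 1), which summation by parts turns into a' times a
    harmonic sum, that is a' ln t + O(1). Induction over the summands gives
    the coefficient c^2 ((sum w)^2 - sum w^2) = 2 c^2 sum_(i < j) w_i w_j.

    For the exact identity, s |-> Pr(w1 Y1 + w2 Y2 > t, w2 Y2 <= s) and an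
    explicit primitive have increments that agree up to O((s' - s)^2), so they
    differ by a constant. *)

(** * Logarithms and harmonic sums *)

Section log_bounds.
Variable R : realType.
Implicit Types x y t : R.

Lemma ln_le_subr1 x : 0 < x -> ln x <= x - 1.
Proof.
move=> x0; rewrite -{1}(subrKC 1 x); apply: le_ln1Dx; lra.
Qed.

Lemma ln_ge_1subV x : 0 < x -> 1 - x^-1 <= ln x.
Proof.
move=> x0; have := @ln_le_subr1 x^-1; rewrite invr_gt0 => /(_ x0).
rewrite lnV ?posrE//; lra.
Qed.

Lemma ln_ratio_bounds x y : 0 < x -> 0 < y ->
  (y - x) / y <= ln y - ln x <= (y - x) / x.
Proof.
move=> x0 y0; rewrite -ln_div ?posrE//.
have yx0 : 0 < y / x by rewrite divr_gt0.
have := ln_le_subr1 yx0; have := ln_ge_1subV yx0; rewrite invf_div.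
have -> : (y - x) / y = 1 - x / y by field; rewrite gt_eqF.
have -> : (y - x) / x = y / x - 1 by field; rewrite gt_eqF.
by move=> -> ->.
Qed.

(** Apply [ln s <= s - 1] at the square root of [x], whose logarithm is half of [ln x]. This later
    lets [ln t ^+ 2] be absorbed by [t]. *)
Lemma sqr_ln_le x : 1 <= x -> ln x ^+ 2 <= 4 * x.
Proof.
move=> x1; have x0 : 0 < x by lra.
have s0 : 0 < Num.sqrt x by rewrite sqrtr_gt0.
have -> : ln x = 2 * ln (Num.sqrt x).
  by rewrite -[in LHS](sqr_sqrtr (ltW x0)) lnXn// mulr_natl.
have s1 : 1 <= Num.sqrt x by rewrite -sqrtr1 ler_wsqrtr.
have l0 := ln_ge0 s1; have ls := ln_le_subr1 s0.
rewrite exprMn -[in leRHS](sqr_sqrtr (ltW x0)).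
have : ln (Num.sqrt x) ^+ 2 <= Num.sqrt x ^+ 2 by rewrite lerXn2r ?nnegrE//; lra.
lra.
Qed.

Lemma ln_succ_bounds N : (N.+2%:R^-1 : R) <= ln (N.+2%:R : R) - ln N.+1%:R <= N.+1%:R^-1.
Proof.
have := @ln_ratio_bounds N.+1%:R N.+2%:R; rewrite !ltr0Sn => /(_ isT isT).
have -> : N.+2%:R - N.+1%:R = 1 :> R by rewrite -[N.+2]addn1 natrD; ring.
by rewrite !div1r.
Qed.

Lemma harmonic_ge_ln N : ln (N.+1%:R : R) <= \sum_(n < N) n.+1%:R^-1.
Proof.
elim: N => [|N IH]; first by rewrite big_ord0 ln1.
rewrite big_ord_recr/=; apply: le_trans (lerD IH (lexx _)).
by have /andP[_] := ln_succ_bounds N; rewrite lerBlDl.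
Qed.

Lemma harmonic_le_ln N : \sum_(n < N.+1) n.+1%:R^-1 <= 1 + ln (N.+1%:R : R).
Proof.
elim: N => [|N IH]; first by rewrite big_ord_recr big_ord0/= ln1 invr1 add0r addr0.
rewrite big_ord_recr/=; apply: le_trans (lerD IH (lexx _)) _.
by have /andP[+ _] := ln_succ_bounds N; rewrite lerBrDl -addrA lerD2l.
Qed.

(* Telescoping comparison: (1 + ln x) / x ^ 2 is minus the derivative of
   (2 + ln x) / x. *)
Lemma ln_sqr_le_telescope x : 1 <= x ->
  (1 + ln x) / x ^+ 2 <= 2 * ((ln x + 2) / x) - 2 * ((ln (x + 1) + 2) / (x + 1)).
Proof.
move=> x1; have x0 : 0 < x by lra.
have x10 : 0 < x + 1 by lra.
have lx := ln_ge0 x1.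
have /andP[_] := ln_ratio_bounds x0 x10.
have -> : (x + 1 - x) / x = x^-1 by rewrite addrAC subrr add0r mul1r.
move=> h.
have u0 : 0 < (x + 1)^-1 by rewrite invr_gt0.
have v0 : 0 < x^-1 by rewrite invr_gt0.
have vu : x^-1 <= 2 * (x + 1)^-1.
  rewrite -[leLHS]mul1r ler_pdivrMr// mulrAC ler_pdivlMr//; lra.
have h2 : (ln (x + 1) + 2) * (x + 1)^-1 <= (ln x + x^-1 + 2) * (x + 1)^-1.
  apply: ler_wpM2r; [exact: ltW | lra].
have h3 : (1 + ln x) / x * x^-1 <= (1 + ln x) / x * (2 * (x + 1)^-1).
  by apply: ler_wpM2l => //; rewrite divr_ge0//; lra.
have e1 : (1 + ln x) / x ^+ 2 = (1 + ln x) / x * x^-1.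
  by field; rewrite gt_eqF.
have e2 : (1 + ln x) / x * (2 * (x + 1)^-1) =
   2 * ((ln x + 2) / x) - 2 * ((ln x + x^-1 + 2) * (x + 1)^-1).
  by field; rewrite !gt_eqF.
rewrite e1; apply: (le_trans h3); rewrite e2 lerD2l lerN2 ler_pM2l//.
Qed.

Lemma sum_ln_sqr_le N :
  \sum_(n < N) (1 + ln (n.+1%:R : R)) / n.+1%:R ^+ 2 <= 4.
Proof.
(* Strengthened for induction: the subtracted term is the part of the telescope not yet spent, and 4
   is the value of [2 * ((ln x + 2) / x)] at [x = 1]. *)
suff : \sum_(n < N) (1 + ln (n.+1%:R : R)) / n.+1%:R ^+ 2 <=
       4 - 2 * ((ln N.+1%:R + 2) / N.+1%:R).
  move=> /le_trans; apply.
  by rewrite gerBl mulr_ge0// divr_ge0// addr_ge0// ln_ge0// ler1n.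
elim: N => [|N IH]; first by rewrite big_ord0 ln1 add0r divr1 -natrM subrr.
rewrite big_ord_recr/=; apply: le_trans (lerD IH (lexx _)) _.
have := @ln_sqr_le_telescope N.+1%:R; rewrite ler1n => /(_ isT).
by rewrite natr1 => h; apply: le_trans (lerD (lexx _) h) _; rewrite addrA subrK.
Qed.

End log_bounds.

(** * Summation by parts for truncated moments *)

Section summation_by_parts.
Variables (R : comPzRingType) (g : nat -> R).

(** When [g] is a tail, [g n - g n.+1] is the mass of []n, n + 1]], so the left side is a
    discretized truncated mean. *)
Lemma sum_mul_decrements N :
  \sum_(n < N) n%:R * (g n - g n.+1) = \sum_(n < N) g n.+1 - N%:R * g N.
Proof.
elim: N => [|N IH]; first by rewrite !big_ord0; ring.
by rewrite !big_ord_recr/= IH -[N.+1]addn1 natrD addn1; ring.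
Qed.

Lemma sum_sqr_mul_decrements N :
  \sum_(n < N) n%:R ^+ 2 * (g n - g n.+1) =
  \sum_(n < N) (2 * n%:R + 1) * g n.+1 - N%:R ^+ 2 * g N.
Proof.
elim: N => [|N IH]; first by rewrite !big_ord0; ring.
by rewrite !big_ord_recr/= IH -[N.+1]addn1 natrD addn1; ring.
Qed.

Lemma sum_decrements N : \sum_(n < N) (g n - g n.+1) = g 0%N - g N.
Proof.
elim: N => [|N IH]; first by rewrite big_ord0 subrr.
by rewrite big_ord_recr/= IH; ring.
Qed.

End summation_by_parts.

(** * Tail expansions *)

Section tail_expansions.
Variable R : realType.
Implicit Types (a b t x y : R) (F G : R -> R).

(** One constant bounds the remainder on all of [[1, +oo[], instead of a Landau symbol, because the
    expansion is used at many points [t - n] at once and the errors are summed. *)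
Definition tail_expansion a b F := exists2 K, 0 <= K &
  forall x, 1 <= x -> `|F x - (a / x + b * (ln x / x ^+ 2))| <= K / x ^+ 2.

(** The derivative of [ln x / x ^+ 2] has size about [ln t / t ^+ 3], so the shift costs at most the
    order of [y * ln t / t ^+ 3]. Bounding [y * ln t] by [y ^+ 2] and [ln t ^+ 2 <= 4 * t] splits
    this into the two error terms. *)
Lemma ln_sqr_shift t y : 2 <= t -> 0 <= y -> y <= t / 2 ->
  `|ln (t - y) / (t - y) ^+ 2 - ln t / t ^+ 2| <=
  12 / t ^+ 2 + 3 * (y ^+ 2 / t ^+ 3).
Proof.
move=> t2 y0 yt; pose x := t - y.
have x1 : 1 <= x by rewrite /x; lra.
have x0 : 0 < x by lra.
have t0 : 0 < t by lra.
have xt : x <= t by rewrite /x; lra.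
have l0 := ln_ge0 x1.
have L0 : 0 <= ln t by rewrite ln_ge0; lra.
have lL : ln x <= ln t by rewrite ler_ln ?posrE.
have /andP[_] := ln_ratio_bounds x0 t0.
have -> : (t - x) / x = y / x by rewrite /x; congr (_ / _); ring.
have L2 : ln t ^+ 2 <= 4 * t by apply: sqr_ln_le; lra.
have u0 : 0 < t^-1 by rewrite invr_gt0.
have v0 : 0 < x^-1 by rewrite invr_gt0.
have tu : t * t^-1 = 1 by rewrite mulfV// gt_eqF.
have xv : x * x^-1 = 1 by rewrite mulfV// gt_eqF.
have yx : y = t - x by rewrite /x; ring.
rewrite -/x -!exprVn; clearbody x.
move: (t^-1) (x^-1) (ln t) (ln x) tu xv u0 v0 l0 L0 lL L2 => u v L l.
move=> tu xv u0 v0 l0 L0 lL L2 Ll.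
have vu : v <= 2 * u.
  rewrite -subr_ge0; have -> : 2 * u - v = u * v * (x - y).
    by rewrite yx; ring: tu xv.
  by rewrite !mulr_ge0 ?(ltW u0) ?(ltW v0)//; lra.
have vmu : v - u = y * u * v by rewrite yx; ring: tu xv.
have uv : u <= v by rewrite -subr_ge0 vmu !mulr_ge0// ltW.
have yv : y * v <= 1.
  by rewrite -xv ler_wpM2r ?(ltW v0)//; lra.
have e1 : v ^+ 2 - u ^+ 2 <= 6 * y * u ^+ 3.
  have -> : v ^+ 2 - u ^+ 2 = y * u * (v * (u + v)) by rewrite subr_sqr vmu; ring.
  have -> : 6 * y * u ^+ 3 = y * u * (2 * u * (3 * u)) by ring.
  apply: ler_wpM2l; first by rewrite mulr_ge0// ltW.
  by apply: ler_pM => //; lra.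
have e2 : L * (v ^+ 2 - u ^+ 2) <= 12 * u ^+ 2 + 3 * (y ^+ 2 * u ^+ 3).
  apply: le_trans (ler_wpM2l L0 e1) _.
  have -> : L * (6 * y * u ^+ 3) = 6 * (L * y) * u ^+ 3 by ring.
  have -> : 12 * u ^+ 2 + 3 * (y ^+ 2 * u ^+ 3) = (12 * t + 3 * y ^+ 2) * u ^+ 3.
    by ring: tu.
  apply: ler_wpM2r; first by rewrite exprn_ge0// ltW.
  (* [6 L y <= 3 L ^+ 2 + 3 y ^+ 2 <= 12 t + 3 y ^+ 2]. *)
  by have := sqr_ge0 (L - y); rewrite sqrrB; lra.
have u20 : 0 <= u ^+ 2 by rewrite sqr_ge0.
have e3 : (L - l) * u ^+ 2 <= u ^+ 2.
  by rewrite -[leRHS]mul1r ler_wpM2r//; lra.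
have e4 : l * u ^+ 2 <= l * v ^+ 2.
  by apply: ler_wpM2l => //; rewrite lerXn2r ?nnegrE// ltW.
have e5 : l * v ^+ 2 <= L * v ^+ 2 by apply: ler_wpM2r => //; rewrite sqr_ge0.
have y2 : 0 <= y ^+ 2 * u ^+ 3 by rewrite mulr_ge0 ?sqr_ge0// exprn_ge0// ltW.
rewrite ler_norml; apply/andP; split; lra.
Qed.

(** The power term is expanded exactly: [a / (t - y)] minus [a / t + a * y / t ^+ 2] equals
    [a * y ^+ 2 / (t ^+ 2 * (t - y))], and [y <= t / 2] keeps [1 / (t - y)] below [2 / t]. *)
Lemma tail_expansion_shift a b F : 0 <= a -> 0 <= b -> tail_expansion a b F ->
  exists2 C, 0 <= C & forall t y, 2 <= t -> 0 <= y -> y <= t / 2 ->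
  `|F (t - y) - (a / t + b * (ln t / t ^+ 2) + a * y / t ^+ 2)| <=
  C * (1 / t ^+ 2 + y ^+ 2 / t ^+ 3).
Proof.
move=> a0 b0 [K K0 HF]; exists (4 * K + 2 * a + 12 * b); first by lra.
move=> t y t2 y0 yt.
have h3 := ln_sqr_shift t2 y0 yt.
have x1 : 1 <= t - y by lra.
have h1 := HF _ x1.
have x0 : 0 < t - y by lra.
have t0 : 0 < t by lra.
have u0 : 0 < t^-1 by rewrite invr_gt0.
have v0 : 0 < (t - y)^-1 by rewrite invr_gt0.
have tu : t * t^-1 = 1 by rewrite mulfV// gt_eqF.
have xv : (t - y) * (t - y)^-1 = 1 by rewrite mulfV// gt_eqF.
move: h1 h3; rewrite -!exprVn mul1r.
move: (F _) (ln (t - y)) (ln t) (t^-1) ((t - y)^-1) tu xv u0 v0.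
move=> f l L u v tu xv u0 v0 h1 h3.
have vu : v <= 2 * u.
  rewrite -subr_ge0; have -> : 2 * u - v = u * v * (t - 2 * y).
    have -> : u * v * (t - 2 * y) = 2 * u * ((t - y) * v) - v * (t * u) by ring.
    by rewrite tu xv !mulr1.
  by rewrite !mulr_ge0 ?(ltW u0) ?(ltW v0)//; lra.
have v2 : v ^+ 2 <= 4 * u ^+ 2.
  by have := ler_pM (ltW v0) (ltW v0) vu vu; rewrite -!expr2 exprMn; lra.
have vmu : v - u = y * u * v.
  have -> : y * u * v = v * (t * u) - u * ((t - y) * v) by ring.
  by rewrite tu xv !mulr1.
have e : a * v - a * u - a * y * u ^+ 2 = a * (y ^+ 2 * u ^+ 2) * v.
  have -> : a * v - a * u - a * y * u ^+ 2 = a * (v - u) - a * y * u ^+ 2 by ring.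
  have -> : a * (y ^+ 2 * u ^+ 2) * v = a * y * u * (y * u * v) by ring.
  rewrite -vmu; have -> : a * (v - u) = a * (y * u * v) by rewrite vmu.
  ring.
have e2 : a * (y ^+ 2 * u ^+ 2) * v <= a * (y ^+ 2 * u ^+ 2) * (2 * u).
  apply: ler_wpM2l => //; apply: mulr_ge0 => //.
  by apply: mulr_ge0; exact: sqr_ge0.
have e3 : 0 <= a * (y ^+ 2 * u ^+ 2) * v.
  apply: mulr_ge0 (ltW v0); apply: mulr_ge0 => //.
  by apply: mulr_ge0; exact: sqr_ge0.
have e4 : K * v ^+ 2 <= K * (4 * u ^+ 2) by apply: ler_wpM2l.
have e5 : `|b * (l * v ^+ 2 - L * u ^+ 2)| <= b * (12 * u ^+ 2 + 3 * (y ^+ 2 * u ^+ 3)).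
  by rewrite normrM (ger0_norm b0) ler_wpM2l.
have k1 : 0 <= K * (y ^+ 2 * u ^+ 3).
  by rewrite mulr_ge0// mulr_ge0 ?sqr_ge0// exprn_ge0// ltW.
have k2 : 0 <= b * (y ^+ 2 * u ^+ 3).
  by rewrite mulr_ge0// mulr_ge0 ?sqr_ge0// exprn_ge0// ltW.
have k3 : 0 <= a * u ^+ 2 by rewrite mulr_ge0 ?sqr_ge0.
move: h1 e5; rewrite !ler_norml => /andP[? ?] /andP[? ?].
by apply/andP; split; lra.
Qed.
(** A crude decay rate, for the places where only the order of magnitude of a tail matters: second
    moments, boundary terms and joint exceedances. *)
Lemma tail_expansion_le a b F : 0 <= a -> 0 <= b -> tail_expansion a b F ->
  exists2 M, 0 <= M & forall x, 1 <= x -> F x <= M / x.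
Proof.
move=> a0 b0 [K K0 HF]; exists (a + b + K); first by lra.
move=> x x1; have x0 : 0 < x by lra.
have := HF x x1; rewrite ler_norml => /andP[_ h].
have ln_x : ln x / x ^+ 2 <= x^-1.
  rewrite ler_pdivrMr ?exprn_gt0// expr2 mulrA mulVf ?gt_eqF// mul1r.
  by have := ln_le_subr1 x0; lra.
have x2 : (x ^+ 2)^-1 <= x^-1.
  by rewrite lef_pV2 ?posrE ?exprn_gt0// expr2 ler_peMl// ltW.
have := ler_wpM2l b0 ln_x; have := ler_wpM2l K0 x2.
lra.
Qed.

(** [N] is the integer part of [t / 2]. Replacing [G n] by [a / n] costs a convergent series, and
    the harmonic sum up to [N] is within 1 of [ln t]. *)
Lemma sum_tail_expansion a b G : 0 <= a -> 0 <= b -> tail_expansion a b G ->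
  exists2 D, 0 <= D & forall t (N : nat), 4 <= t -> N%:R <= t / 2 ->
  t / 2 < N.+1%:R -> `|\sum_(n < N) G n.+1%:R - a * ln t| <= D.
Proof.
move=> a0 b0 [K K0 HG]; exists (a + 4 * (b + K)); first by lra.
move=> t N t4 Nt tN.
have t0 : 0 < t by lra.
have e1 : `|\sum_(n < N) G n.+1%:R - a * \sum_(n < N) n.+1%:R^-1| <= (b + K) * 4.
  rewrite mulr_sumr -sumrB; apply: le_trans (ler_norm_sum _ _ _) _.
  apply: le_trans (ler_wpM2l (addr_ge0 b0 K0) (sum_ln_sqr_le R N)).
  rewrite mulr_sumr; apply: ler_sum => n _.
  have n1 : 1 <= n.+1%:R :> R by rewrite ler1n.
  have := HG _ n1; move: (n.+1%:R) n1 => x x1.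
  have x0 : 0 < x by lra.
  rewrite !ler_norml => /andP[h1 h2].
  have q0 : 0 <= (x ^+ 2)^-1 by rewrite invr_ge0 sqr_ge0.
  have := mulr_ge0 b0 (mulr_ge0 (ln_ge0 x1) q0).
  have := mulr_ge0 K0 (mulr_ge0 (ln_ge0 x1) q0).
  have := mulr_ge0 b0 q0; have := mulr_ge0 K0 q0.
  by move=> *; apply/andP; split; lra.
have e2 : `|\sum_(n < N) n.+1%:R^-1 - ln t| <= 1.
  case: N Nt tN {e1} => [|N] Nt tN; first by move: tN; rewrite ltr_pdivrMr//; lra.
  have N0 : 0 < N.+1%:R :> R by rewrite ltr0n.
  have := harmonic_ge_ln R N.+1; have := harmonic_le_ln R N.
  have : ln N.+1%:R <= ln t by rewrite ler_ln ?posrE//; lra.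
  have : ln (t / 2) <= ln N.+2%:R by rewrite ler_ln ?posrE ?ltr0n ?ltW// divr_gt0.
  have : ln 2 <= 2 - 1 :> R by apply: ln_le_subr1; lra.
  rewrite ln_div ?posrE//; move: (\sum_(_ < _) _) (ln N.+1%:R) (ln N.+2%:R) => s l1 l2.
  by move=> *; rewrite ler_norml; apply/andP; split; lra.
rewrite -(subrKA (a * \sum_(n < N) n.+1%:R^-1)); apply: le_trans (ler_normD _ _) _.
rewrite [leRHS]addrC; apply: lerD; first by rewrite [leRHS]mulrC.
by rewrite -mulrBr normrM (ger0_norm a0) ler_piMr.
Qed.

(* The sum is a discretization, with unit steps, of the integral of
   F (t - y) against the law with tail G, over y <= t / 2. *)
Lemma discrete_convolution_expansion a b F a' b' G :
  0 <= a -> 0 <= b -> tail_expansion a b F ->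
  0 <= a' -> 0 <= b' -> tail_expansion a' b' G ->
  (forall x, 0 <= G x <= 1) -> {homo G : x y /~ x <= y} ->
  exists2 C, 0 <= C & forall t (N : nat) e, 4 <= t -> N%:R <= t / 2 ->
  t / 2 < N.+1%:R -> 0 <= e -> e <= 1 ->
  `|(1 - G 0) * F t + \sum_(n < N) (G n%:R - G n.+1%:R) * F (t - (n%:R + e))
    - (a / t + (b + a * a') * (ln t / t ^+ 2))| <= C / t ^+ 2.
Proof.
move=> a0 b0 HF a'0 b'0 HG G01 Gmono.
have [C1 C10 hF] := tail_expansion_shift a0 b0 HF.
have [M M0 hG] := tail_expansion_le a'0 b'0 HG.
have [D D0 hS] := sum_tail_expansion a'0 b'0 HG.
(* [2 * C1] comes from [(n + e) ^+ 2 <= 2 * n ^+ 2 + 2], and [a * 1] from replacing [a * (n + e)] by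
   [a * n] with [e <= 1]. *)
pose E := 2 * C1 + a * 1.
have E0 : 0 <= E by rewrite /E; lra.
exists (2 * E + E * M + 4 * (a + b) * M + a * D + a * M).
  by rewrite !addr_ge0 ?mulr_ge0//; lra.
(* The offset [e] selects an end of each unit interval: 0 gives the lower and 1 the upper
   approximation, with the same constant for both. *)
move=> t N e t4 Nt tN e0 e1.
have t0 : 0 < t by lra.
have u0 : 0 < t^-1 by rewrite invr_gt0.
have tu : t * t^-1 = 1 by rewrite mulfV// gt_eqF.
have hS' := hS t N t4 Nt tN.
pose g n := G n%:R.
have g01 n : 0 <= g n <= 1 by exact: G01.
have gle n : g n.+1 <= g n by apply: Gmono; rewrite ler_nat.
have gM n : g n.+1 <= M / n.+1%:R by apply: hG; rewrite ler1n.
pose A := a / t + b * (ln t / t ^+ 2).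
pose u := t^-1.
have hF0 : `|F t - A| <= C1 * u ^+ 2.
  have := hF t 0 _ _ _; rewrite subr0 mulr0 mul0r addr0 expr0n mul0r addr0 mul1r.
  by rewrite exprVn; apply; lra.
have hFn (n : 'I_N) :
    `|F (t - (n%:R + e)) - (A + a * n%:R * u ^+ 2)| <= E * (u ^+ 2 + n%:R ^+ 2 * u ^+ 3).
  have nN : n%:R + 1 <= N%:R :> R by rewrite natr1 ler_nat.
  have n0 : 0 <= n%:R :> R by [].
  have := hF t (n%:R + e) _ _ _.
  move=> /(_ ltac:(lra) ltac:(lra) ltac:(lra)).
  rewrite -!exprVn mul1r -/u.
  move: (n%:R) n0 (F _) => x x0 f.
  have u20 : 0 <= u ^+ 2 by rewrite sqr_ge0.
  have u3 : u ^+ 3 <= u ^+ 2 * 4^-1.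
    rewrite exprSr ler_wpM2l// /u lef_pV2 ?posrE//; lra.
  have u30 : 0 <= u ^+ 3 by rewrite exprn_ge0// ltW.
  have xe : (x + e) ^+ 2 <= 2 * x ^+ 2 + 2.
    have := sqr_ge0 (x - e); have : e ^+ 2 <= 1 by rewrite expr_le1.
    by rewrite !sqrrD sqrrN; lra.
  have h1 := ler_wpM2r u30 xe.
  have h2 : C1 * (u ^+ 2 + (x + e) ^+ 2 * u ^+ 3) <= 2 * C1 * (u ^+ 2 + x ^+ 2 * u ^+ 3).
    have -> : 2 * C1 * (u ^+ 2 + x ^+ 2 * u ^+ 3) =
        C1 * (2 * (u ^+ 2 + x ^+ 2 * u ^+ 3)) by ring.
    by apply: ler_wpM2l => //; lra.
  have h3 : 0 <= a * e * u ^+ 2 by rewrite mulr_ge0 // mulr_ge0.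
  have h4 : a * e * u ^+ 2 <= a * u ^+ 2 by rewrite ler_wpM2r// ler_piMr.
  have h5 : 0 <= a * (x ^+ 2 * u ^+ 3) by rewrite mulr_ge0// mulr_ge0// sqr_ge0.
  rewrite /A /E -exprVn -/u !ler_norml => /andP[? ?].
  by apply/andP; split; lra.
(* The second moment is [O(t)]: after summation by parts, each of the [N <= t / 2] terms is at most
   [2 * M]. The factor [u ^+ 3] then makes it [O(t^-2)]. *)
have sum2 : \sum_(n < N) n%:R ^+ 2 * (g n - g n.+1) <= M * t.
  rewrite sum_sqr_mul_decrements.
  have : \sum_(n < N) (2 * n%:R + 1) * g n.+1 <= \sum_(n < N) 2 * M.
    apply: ler_sum => n _.
    have n0 : 0 <= n%:R :> R by [].
    have h : 0 <= 2 * n%:R + 1 :> R by lra.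
    apply: le_trans (ler_wpM2l h (gM n)) _.
    rewrite mulrA ler_pdivrMr ?ltr0n// -natr1.
    by have := mulr_ge0 n0 M0; lra.
  rewrite sumr_const card_ord -mulr_natr => h1.
  have h2 : 0 <= N%:R ^+ 2 * g N by rewrite mulr_ge0 ?sqr_ge0//; have /andP[] := g01 N.
  have h3 := ler_wpM2l M0 Nt.
  move: h1 h2; move: (\sum_(_ < _) _) (_ * g N) => s1 s2; lra.
have sum1 := sum_mul_decrements g N.
have sum0 := sum_decrements g N.
have hsum : `|\sum_(n < N) (g n - g n.+1) * F (t - (n%:R + e))
      - \sum_(n < N) (g n - g n.+1) * (A + a * n%:R * u ^+ 2)| <=
    E * u ^+ 2 * \sum_(n < N) (g n - g n.+1) +
    E * u ^+ 3 * \sum_(n < N) n%:R ^+ 2 * (g n - g n.+1).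
  rewrite -sumrB; apply: le_trans (ler_norm_sum _ _ _) _.
  rewrite !mulr_sumr -big_split/=; apply: ler_sum => n _.
  have d0 : 0 <= g n - g n.+1 by rewrite subr_ge0.
  rewrite -mulrBr normrM (ger0_norm d0).
  apply: le_trans (ler_wpM2l d0 (hFn n)) _.
  by rewrite le_eqVlt; apply/orP; left; apply/eqP; ring.
(* The main part splits into the total mass times [A] and the truncated mean, from which the new
   logarithm arises. *)
have esum : \sum_(n < N) (g n - g n.+1) * (A + a * n%:R * u ^+ 2) =
    A * \sum_(n < N) (g n - g n.+1) + a * u ^+ 2 * \sum_(n < N) n%:R * (g n - g n.+1).
  rewrite !mulr_sumr -big_split/=; apply: eq_bigr => n _; ring.
have N0 : (0 < N)%N.
  rewrite lt0n; apply/eqP => N0; have : t / 2 < 1 by move: tN; rewrite N0.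
  by lra.
have N4 : t / 4 <= N%:R by move: tN; rewrite -(natr1 N); lra.
have gN : g N <= M * (4 * u).
  have := gM N.-1; rewrite prednK// => /le_trans; apply.
  apply: ler_wpM2l => //; rewrite -[X in X <= _]invrK -[4 * u]invrK.
  rewrite lef_pV2 ?posrE ?invr_gt0 ?ltr0n ?mulr_gt0// invrK invfM invrK mulrC//.
have NgN : N%:R * g N <= M.
  have := gM N.-1; rewrite prednK// ler_pdivlMr ?ltr0n// mulrC//.
have /andP[gN0 gN1] := g01 N.
have /andP[g00 g01'] := g01 0%N.
move: hsum sum2; rewrite esum sum1 sum0 => hsum sum2.
have L0 : 0 <= ln t by rewrite ln_ge0; lra.
have Lt : ln t * u <= 1.
  rewrite -tu ler_wpM2r ?(ltW u0)//; have := ln_le_subr1 t0; lra.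
rewrite -[G 0]/(g 0%N).
have -> : \sum_(n < N) (G n%:R - G n.+1%:R) * F (t - (n%:R + e)) =
  \sum_(n < N) (g n - g n.+1) * F (t - (n%:R + e)) by [].
have hS2 : `|\sum_(n < N) g n.+1 - a' * ln t| <= D := hS'.
move: hsum sum2 hS2.
set T := \sum_(n < N) (g n - g n.+1) * F _.
set S := \sum_(n < N) g n.+1.
set s2 := \sum_(n < N) _ ^+ 2 * _.
rewrite -!exprVn -/u => hsum sum2 hS2.
have eA : A = a * u + b * (ln t * u ^+ 2) by rewrite /A -exprVn.
have u20 : 0 <= u ^+ 2 by rewrite sqr_ge0.
have u30 : 0 <= u ^+ 3 by rewrite exprn_ge0// ltW.
have k1 : `|(1 - g 0%N) * (F t - A)| <= E * u ^+ 2.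
  rewrite normrM ger0_norm ?subr_ge0//.
  have q1 : (1 - g 0%N) * `|F t - A| <= 1 * `|F t - A| by rewrite ler_wpM2r//; lra.
  have q2 : C1 * u ^+ 2 <= E * u ^+ 2 by rewrite ler_wpM2r// /E; lra.
  by apply: le_trans q1 _; rewrite mul1r; exact: le_trans hF0 q2.
have k2 : E * u ^+ 2 * (g 0%N - g N) <= E * u ^+ 2.
  by rewrite ler_piMr ?(mulr_ge0 E0 u20)//; lra.
have k3 : E * u ^+ 3 * s2 <= E * M * u ^+ 2.
  have -> : E * M * u ^+ 2 = E * u ^+ 3 * (M * t).
    have -> : E * u ^+ 3 * (M * t) = E * M * u ^+ 2 * (t * u) by ring.
    by rewrite tu mulr1.
  have Eu := mulr_ge0 E0 u30.
  by apply: ler_wpM2l sum2.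
have au : 0 <= a * u ^+ 2 := mulr_ge0 a0 u20.
have k4 : `|a * u ^+ 2 * (S - a' * ln t)| <= a * D * u ^+ 2.
  rewrite normrM (ger0_norm au) (mulrAC a D).
  by apply: ler_wpM2l hS2.
have k5 : a * u ^+ 2 * (N%:R * g N) <= a * M * u ^+ 2.
  by rewrite (mulrAC a M); apply: ler_wpM2l NgN.
have k6 : 0 <= a * u ^+ 2 * (N%:R * g N).
  by apply: mulr_ge0 => //; apply: mulr_ge0.
have A0 : 0 <= A.
  rewrite eA; apply: addr_ge0; apply: mulr_ge0 => //; first exact: ltW.
  exact: mulr_ge0.
have AM : A <= (a + b) * u.
  rewrite eA mulrDl lerD2l; apply: ler_wpM2l => //.
  by rewrite expr2 mulrA ler_piMl// ltW.
have k7 : A * g N <= 4 * (a + b) * M * u ^+ 2.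
  apply: le_trans (ler_pM A0 gN0 AM gN) _.
  by rewrite le_eqVlt; apply/orP; left; apply/eqP; ring.
have k8 : 0 <= A * g N by rewrite mulr_ge0.
(* The weights [1 - g 0], [g 0 - g N] and [g N] of [A] add up to 1, and replacing [S] by [a' * ln t]
   produces the coefficient [a * a']. Each of the five pieces is [O(u ^+ 2)]. *)
have -> : (1 - g 0%N) * F t + T - (a * u + (b + a * a') * (ln t * u ^+ 2)) =
  (1 - g 0%N) * (F t - A) + (T - (A * (g 0%N - g N) + a * u ^+ 2 * (S - N%:R * g N)))
  + a * u ^+ 2 * (S - a' * ln t) - a * u ^+ 2 * (N%:R * g N) - A * g N.
  by rewrite eA; ring.
move: k1 k4 hsum; rewrite !ler_norml => /andP[? ?] /andP[? ?] /andP[? ?].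
by apply/andP; split; lra.
Qed.

End tail_expansions.

(** * Tails of sums of two independent variables *)

Section real_probability.
Variables (R : realType) (d : measure_display) (Omega : measurableType d).
Variable P : probability Omega R.
Implicit Types (A B : set Omega) (X Y : Omega -> R).

Lemma measurable_gt X t : measurable_fun setT X -> measurable [set o | t < X o].
Proof.
move=> mX; have := mX measurableT `]t, +oo[%classic (measurable_itv _).
by rewrite setTI; congr measurable; apply/seteqP; split => o; rewrite /= in_itv/= andbT.
Qed.

Lemma measurable_le X t : measurable_fun setT X -> measurable [set o | X o <= t].
Proof.
move=> mX; have := mX measurableT `]-oo, t]%classic (measurable_itv _).
by rewrite setTI; congr measurable; apply/seteqP; split => o; rewrite /= in_itv/=.
Qed.

(** A real-valued copy of [P], so that inequalities between probabilities are within reach of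
    [lra]. *)
Definition prob A : R := fine (P A).

Lemma prE A : measurable A -> P A = (prob A)%:E.
Proof. by move=> mA; rewrite /prob fineK// fin_num_measure. Qed.

Lemma pr_ge0 A : 0 <= prob A.
Proof. by rewrite /prob fine_ge0. Qed.

Lemma pr_setT : prob setT = 1.
Proof. by rewrite /prob probability_setT. Qed.

Lemma le_pr A B : measurable A -> measurable B -> A `<=` B -> prob A <= prob B.
Proof.
move=> mA mB AB; rewrite -lee_fin -!prE//.
by apply: le_measure => //; rewrite inE.
Qed.

Lemma pr_le1 A : measurable A -> prob A <= 1.
Proof. by move=> mA; rewrite -pr_setT le_pr. Qed.

Lemma prU A B : measurable A -> measurable B -> A `&` B = set0 ->
  prob (A `|` B) = prob A + prob B.
Proof.
move=> mA mB AB; apply: EFin_inj; rewrite EFinD -!prE//; last exact: measurableU.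
by rewrite measureU.
Qed.

Lemma pr_split A B : measurable A -> measurable B ->
  prob A = prob (A `&` B) + prob (A `&` ~` B).
Proof.
move=> mA mB; rewrite -prU; first by rewrite -setIUr setUv setIT.
- exact: measurableI.
- by apply: measurableI => //; exact: measurableC.
- by rewrite setIACA setICr setI0.
Qed.

Lemma prU_le A B : measurable A -> measurable B -> prob (A `|` B) <= prob A + prob B.
Proof.
move=> mA mB; have mU := measurableU _ _ mA mB.
rewrite (pr_split mU mA) lerD// le_pr//.
- exact: measurableI.
- by apply: measurableI => //; exact: measurableC.
- by move=> o [[]].
Qed.

Definition survival X (t : R) := prob [set o | t < X o].

Lemma tail_ge0 X t : 0 <= survival X t.
Proof. exact: pr_ge0. Qed.

Lemma tail_le1 X t : measurable_fun setT X -> survival X t <= 1.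
Proof. by move=> mX; apply: pr_le1; exact: measurable_gt. Qed.

Lemma tail_nonincreasing X : measurable_fun setT X -> {homo survival X : x y /~ x <= y}.
Proof.
move=> mX x y xy; apply: le_pr; [exact: measurable_gt..|].
by move=> o /=; exact: le_lt_trans.
Qed.

Lemma pr_le_tail X t : measurable_fun setT X -> prob [set o | X o <= t] = 1 - survival X t.
Proof.
move=> mX; have := pr_split measurableT (measurable_gt t mX).
rewrite pr_setT !setTI => ->; rewrite addrAC subrr add0r; congr prob.
by apply/seteqP; split => o /=; rewrite leNgt => /negP.
Qed.

Lemma pr_itv_tail X x y : measurable_fun setT X -> x <= y ->
  prob [set o | x < X o <= y] = survival X x - survival X y.
Proof.
move=> mX xy; rewrite /survival (pr_split (measurable_gt x mX) (measurable_gt y mX)).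
have -> : [set o | x < X o] `&` [set o | y < X o] = [set o | y < X o].
  by apply/seteqP; split => o /=; [case|move=> h; split=> //; exact: le_lt_trans xy h].
rewrite addrAC subrr add0r; congr prob; apply/seteqP; split => o /=.
  by move=> /andP[-> h]; split => //; apply/negP; rewrite -leNgt.
by move=> [-> /negP]; rewrite -leNgt.
Qed.

Definition independent2 X Y := forall B C : set R, measurable B -> measurable C ->
  P (X @^-1` B `&` Y @^-1` C) = (P (X @^-1` B) * P (Y @^-1` C))%E.

Lemma independent2C X Y : independent2 X Y -> independent2 Y X.
Proof. by move=> h B C mB mC; rewrite setIC muleC h. Qed.

End real_probability.

(** * Slicing the event of a large sum into rectangles *)

Section convolution.
Variables (R : realType) (d : measure_display) (Omega : measurableType d).
Variable P : probability Omega R.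
Variables X Y : Omega -> R.
Hypotheses (mX : measurable_fun setT X) (mY : measurable_fun setT Y).
Hypothesis XY : independent2 P X Y.
Local Notation pr := (prob P).
Local Notation F := (survival P X).
Local Notation G := (survival P Y).

Let measurable_preim (Z : Omega -> R) (B : set R) :
  measurable_fun setT Z -> measurable B -> measurable (Z @^-1` B).
Proof. by move=> mZ mB; rewrite -[_ @^-1` _]setTI; exact: mZ. Qed.

Lemma pr_independent2 (B C : set R) : measurable B -> measurable C ->
  pr (X @^-1` B `&` Y @^-1` C) = pr (X @^-1` B) * pr (Y @^-1` C).
Proof.
move=> mB mC; have := XY mB mC.
rewrite !(prE P); try (by apply: measurable_preim);
  last by apply: measurableI; exact: measurable_preim.
by rewrite -EFinM; case.
Qed.

Lemma pr_gt_le s y : pr [set o | s < X o /\ Y o <= y] = (1 - G y) * F s.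
Proof.
have := pr_independent2 (measurable_itv `]s, +oo[) (measurable_itv `]-oo, y]).
rewrite mulrC -(pr_le_tail _ _ mY) /survival.
have -> : X @^-1` `]s, +oo[%classic = [set o | s < X o].
  by apply/seteqP; split => o; rewrite /= in_itv/= andbT.
have -> // : Y @^-1` `]-oo, y]%classic = [set o | Y o <= y].
by apply/seteqP; split => o; rewrite /= in_itv/=.
Qed.

Lemma pr_gt_gt s y : pr [set o | s < X o /\ y < Y o] = F s * G y.
Proof.
have := pr_independent2 (measurable_itv `]s, +oo[) (measurable_itv `]y, +oo[).
rewrite /survival.
have -> : X @^-1` `]s, +oo[%classic = [set o | s < X o].
  by apply/seteqP; split => o; rewrite /= in_itv/= andbT.
have -> // : Y @^-1` `]y, +oo[%classic = [set o | y < Y o].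
by apply/seteqP; split => o; rewrite /= in_itv/= andbT.
Qed.

Lemma pr_gt_itv s x y : x <= y ->
  pr [set o | s < X o /\ x < Y o <= y] = (G x - G y) * F s.
Proof.
move=> xy.
have := pr_independent2 (measurable_itv `]s, +oo[) (measurable_itv `]x, y]).
rewrite mulrC -(pr_itv_tail _ mY xy) /survival.
have -> : X @^-1` `]s, +oo[%classic = [set o | s < X o].
  by apply/seteqP; split => o; rewrite /= in_itv/= andbT.
have -> // : Y @^-1` `]x, y]%classic = [set o | x < Y o <= y].
by apply/seteqP; split => o; rewrite /= in_itv/=.
Qed.

Let measurable_sum_gt t : measurable [set o | t < X o + Y o].
Proof. by apply: measurable_gt; exact: measurable_funD. Qed.

Lemma measurable_sum_gt_le t y : measurable [set o | t < X o + Y o /\ Y o <= y].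
Proof. exact: measurableI (measurable_sum_gt t) (measurable_le y mY). Qed.

Lemma measurable_gt_itv s x y : measurable [set o | s < X o /\ x < Y o <= y].
Proof.
have -> : [set o | s < X o /\ x < Y o <= y] =
    [set o | s < X o] `&` ([set o | x < Y o] `&` [set o | Y o <= y]).
  by apply/seteqP; split => o /= [? /andP].
apply: measurableI; first exact: measurable_gt.
by apply: measurableI; [exact: measurable_gt|exact: measurable_le].
Qed.

Lemma measurable_sum_gt_itv t x y : measurable [set o | t < X o + Y o /\ x < Y o <= y].
Proof.
have -> : [set o | t < X o + Y o /\ x < Y o <= y] =
    [set o | t < X o + Y o] `&` ([set o | x < Y o] `&` [set o | Y o <= y]).
  by apply/seteqP; split => o /= [? /andP].
apply: measurableI => //.
by apply: measurableI; [exact: measurable_gt|exact: measurable_le].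
Qed.

Lemma pr_sum_gt_step t x y : x <= y ->
  pr [set o | t < X o + Y o /\ Y o <= y] =
  pr [set o | t < X o + Y o /\ Y o <= x] + pr [set o | t < X o + Y o /\ x < Y o <= y].
Proof.
move=> xy; rewrite -prU; last 3 first.
- exact: measurable_sum_gt_le.
- exact: measurable_sum_gt_itv.
- apply/seteqP; split => o //= [[_ h] [_ /andP[h' _]]].
  by move: (lt_le_trans h' h); rewrite ltxx.
congr pr; apply/seteqP; split => o /=.
  by move=> [ht hy]; case: (leP (Y o) x) => h; [left|right; rewrite hy].
by move=> [[ht hx]|[ht /andP[_ hy]]]; split => //; exact: le_trans hx xy.
Qed.

(** If [n < Y <= n + 1], then [X + Y > t] forces [X > t - (n + 1)], and independence factors the
    resulting rectangle. The first term is the slab [Y <= 0]. *)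
Lemma pr_sum_gt_le_upper t N : pr [set o | t < X o + Y o /\ Y o <= N%:R] <=
  (1 - G 0) * F t + \sum_(n < N) (G n%:R - G n.+1%:R) * F (t - (n%:R + 1)).
Proof.
elim: N => [|N IH].
  rewrite big_ord0 addr0 -pr_gt_le; apply: le_pr.
  - exact: measurable_sum_gt_le.
  - by apply: measurableI; [exact: measurable_gt|exact: measurable_le].
  - by move=> o /= [? ?]; split => //; lra.
rewrite (@pr_sum_gt_step _ N%:R) ?ler_nat//.
rewrite big_ord_recr/= addrA; apply: lerD IH _.
rewrite -pr_gt_itv ?ler_nat//; apply: le_pr.
- exact: measurable_sum_gt_itv.
- exact: measurable_gt_itv.
- by rewrite -natr1 => o /= [? /andP[? ?]]; split; [lra|apply/andP].
Qed.

(** The opposite inclusion: [X > t - n] and [Y > n] imply [X + Y > t]. On the slab [Y <= 0] the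
    implication from [X > t] is guaranteed only for [Y >= 0], so the null event [Y < 0] is added. *)
Lemma pr_sum_gt_le_lower t N : pr [set o | Y o < 0] = 0 ->
  (1 - G 0) * F t + \sum_(n < N) (G n%:R - G n.+1%:R) * F (t - (n%:R + 0)) <=
  pr [set o | t < X o + Y o /\ Y o <= N%:R].
Proof.
move=> Y0; elim: N => [|N IH].
  rewrite big_ord0 addr0 -pr_gt_le -[leRHS]addr0 -Y0.
  have mY0 : measurable [set o | Y o < 0].
    rewrite (_ : [set o | Y o < 0] = ~` [set o | 0 <= Y o]).
      apply: measurableC; have := measurable_le 0 (measurable_funN mY).
      by congr measurable; apply/seteqP; split => o /=; rewrite oppr_le0.
    by apply/seteqP; split => o /=; rewrite ltNge => /negP.
  apply: le_trans (prU_le P _ mY0); last exact: measurable_sum_gt_le.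
  apply: le_pr.
  - by apply: measurableI; [exact: measurable_gt|exact: measurable_le].
  - by apply: measurableU => //; exact: measurable_sum_gt_le.
  - move=> o /= [? ?]; case: (ltP (Y o) 0) => h; first by right.
    by left; split => //; lra.
rewrite (@pr_sum_gt_step _ N%:R) ?ler_nat//.
rewrite big_ord_recr/= addrA; apply: lerD IH _.
rewrite -pr_gt_itv ?ler_nat//; apply: le_pr.
- exact: measurable_gt_itv.
- exact: measurable_sum_gt_itv.
- by move=> o /= [? /andP[? ?]]; split; [lra|apply/andP].
Qed.

End convolution.

(** * Closure of tail expansions under independent sums *)

Section convolution_expansion.
Variables (R : realType) (d : measure_display) (Omega : measurableType d).
Variable P : probability Omega R.
Local Notation pr := (prob P).
Local Notation tail := (survival P).

(** On [[1, t0[] the error is at most [1 + a + b], while [t0 ^+ 2 / x ^+ 2 >= 1], so a larger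
    constant covers that range. *)
Lemma tail_expansion_eventually a b X t0 K : measurable_fun setT X ->
  0 <= a -> 0 <= b -> 1 <= t0 -> 0 <= K ->
  (forall x : R, t0 <= x ->
    `|tail X x - (a / x + b * (ln x / x ^+ 2))| <= K / x ^+ 2) ->
  tail_expansion a b (tail X).
Proof.
move=> mX a0 b0 t01 K0 H; exists (K + (1 + a + b) * t0 ^+ 2).
  by rewrite addr_ge0// mulr_ge0 ?sqr_ge0//; lra.
move=> x x1; have x0 : 0 < x by lra.
have q0 : 0 <= (x ^+ 2)^-1 by rewrite invr_ge0 sqr_ge0.
have [xt|xt] := leP t0 x.
  apply: le_trans (H _ xt) _; rewrite ler_wpM2r// lerDl.
  by rewrite mulr_ge0 ?sqr_ge0//; lra.
have t2 : 1 <= t0 ^+ 2 * (x ^+ 2)^-1.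
  by rewrite ler_pdivlMr ?exprn_gt0// mul1r lerXn2r ?nnegrE//; lra.
have v1 : x^-1 <= 1 by rewrite invf_le1.
have v0 : 0 <= x^-1 by rewrite invr_ge0 ltW.
have lx : 0 <= ln x / x ^+ 2 by rewrite divr_ge0 ?ln_ge0 ?sqr_ge0.
have lx1 : ln x / x ^+ 2 <= 1.
  rewrite ler_pdivrMr ?exprn_gt0// mul1r.
  have := ln_le_subr1 x0; have : x * 1 <= x * x by rewrite ler_pM2l.
  by rewrite -expr2; lra.
have p0 := tail_ge0 P X x; have p1 := tail_le1 P x mX.
have h1 := ler_wpM2l a0 v1; have h2 := ler_wpM2l b0 lx1.
have h3 := mulr_ge0 a0 v0; have h4 := mulr_ge0 b0 lx.
have h5 : 0 <= (1 + a + b) * (t0 ^+ 2 * (x ^+ 2)^-1 - 1) by rewrite mulr_ge0//; lra.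
have h6 := mulr_ge0 K0 q0.
rewrite ler_norml; apply/andP; split; lra.
Qed.

Variables X Y : Omega -> R.
Hypotheses (mX : measurable_fun setT X) (mY : measurable_fun setT Y).
Hypothesis XY : independent2 P X Y.
Hypotheses (X0 : pr [set o | X o < 0] = 0) (Y0 : pr [set o | Y o < 0] = 0).

Lemma tail_sum_le t N : tail (X \+ Y) t <=
  pr [set o | t < X o + Y o /\ Y o <= N%:R] +
  pr [set o | t < Y o + X o /\ X o <= N%:R] + tail X N%:R * tail Y N%:R.
Proof.
have m1 := measurable_sum_gt_le mX mY t N%:R.
have m2 := measurable_sum_gt_le mY mX t N%:R.
have m3 : measurable [set o | N%:R < X o /\ N%:R < Y o].
  by apply: measurableI; exact: measurable_gt.
rewrite -pr_gt_gt//.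
apply: le_trans (lerD (prU_le P m1 m2) (lexx _)).
apply: le_trans (prU_le P (measurableU _ _ m1 m2) m3).
apply: le_pr.
- by apply: measurable_gt; exact: measurable_funD.
- by apply: measurableU => //; exact: measurableU.
- move=> o /= h; case: (leP (Y o) N%:R) => hY; first by left; left.
  case: (leP (X o) N%:R) => hX; last by right.
  by left; right; split => //; rewrite addrC.
Qed.

(** [X <= N] and [Y <= N] together give [X + Y <= 2 * N <= t], so the two events are disjoint. *)
Lemma tail_sum_ge t N : N%:R <= t / 2 ->
  pr [set o | t < X o + Y o /\ Y o <= N%:R] +
  pr [set o | t < Y o + X o /\ X o <= N%:R] <= tail (X \+ Y) t.
Proof.
move=> Nt.
have m1 := measurable_sum_gt_le mX mY t N%:R.
have m2 := measurable_sum_gt_le mY mX t N%:R.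
rewrite -prU//; last first.
  by apply/seteqP; split => o //= [[h1 h2] [h3 h4]]; lra.
apply: le_pr.
- exact: measurableU.
- by apply: measurable_gt; exact: measurable_funD.
- by move=> o /= [[]|[+ _]] //; rewrite addrC.
Qed.

(** The two halves are discrete convolutions with the roles of [X] and [Y] exchanged; each
    contributes [a * a'], hence the factor 2. *)
Lemma tail_expansionD a b a' b' : 0 <= a -> 0 <= b -> 0 <= a' -> 0 <= b' ->
  tail_expansion a b (tail X) -> tail_expansion a' b' (tail Y) ->
  tail_expansion (a + a') (b + b' + 2 * (a * a')) (tail (X \+ Y)).
Proof.
move=> a0 b0 a'0 b'0 hX hY.
have X01 x : 0 <= tail X x <= 1 by rewrite tail_ge0 tail_le1.
have Y01 x : 0 <= tail Y x <= 1 by rewrite tail_ge0 tail_le1.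
have [C1 C10 H1] := discrete_convolution_expansion a0 b0 hX a'0 b'0 hY Y01
  (tail_nonincreasing P mY).
have [C2 C20 H2] := discrete_convolution_expansion a'0 b'0 hY a0 b0 hX X01
  (tail_nonincreasing P mX).
have [M M0 hM] := tail_expansion_le a0 b0 hX.
have [M' M'0 hM'] := tail_expansion_le a'0 b'0 hY.
have MM' := mulr_ge0 M0 M'0.
apply: (@tail_expansion_eventually _ _ _ 4 (C1 + C2 + 16 * (M * M'))).
- exact: measurable_funD.
- by lra.
- by have := mulr_ge0 a0 a'0; lra.
- by lra.
- by lra.
(* Small enough for disjointness, yet [N >= t / 4], so both variables exceed [N] with probability at
   most [(4 M / t) (4 M' / t)]; hence the 16. *)
move=> t t4; set N := Num.trunc (t / 2).
have t20 : 0 <= t / 2 by lra.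
have /andP[Nt tN] := truncn_itv t20; rewrite -/N in Nt tN.
have u0 : 0 < t^-1 by rewrite invr_gt0; lra.
have N1 : 1 <= N%:R :> R.
  by rewrite ler1n lt0n; apply/eqP => N0; move: tN; rewrite N0; lra.
have N4 : N%:R^-1 <= 4 * t^-1.
  rewrite -[leRHS]invrK lef_pV2 ?posrE ?invr_gt0 ?mulr_gt0//; last by lra.
  by rewrite invfM invrK; move: tN; rewrite -(natr1 N); lra.
have XN : tail X N%:R <= M * (4 * t^-1).
  by apply: le_trans (hM _ N1) _; apply: ler_wpM2l.
have YN : tail Y N%:R <= M' * (4 * t^-1).
  by apply: le_trans (hM' _ N1) _; apply: ler_wpM2l.
have XYN : tail X N%:R * tail Y N%:R <= 16 * (M * M') * (t ^+ 2)^-1.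
  apply: le_trans (ler_pM (tail_ge0 _ _ _) (tail_ge0 _ _ _) XN YN) _.
  by rewrite -exprVn le_eqVlt; apply/orP; left; apply/eqP; ring.
have := tail_sum_le t N; have := tail_sum_ge Nt.
have := pr_sum_gt_le_upper mX mY XY t N.
have := pr_sum_gt_le_upper mY mX (independent2C XY) t N.
have := pr_sum_gt_le_lower mX mY XY t N Y0.
have := pr_sum_gt_le_lower mY mX (independent2C XY) t N X0.
have := H1 t N 0 t4 Nt tN (lexx _) ler01.
have := H1 t N 1 t4 Nt tN ler01 (lexx _).
have := H2 t N 0 t4 Nt tN (lexx _) ler01.
have := H2 t N 1 t4 Nt tN ler01 (lexx _).
move: XYN.
set s1 := _ + \sum_(n < N) _ * tail Y (t - (_ + 1)).
set s2 := _ + \sum_(n < N) _ * tail Y (t - (_ + 0)).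
set s3 := _ + \sum_(n < N) _ * tail X (t - (_ + 1)).
set s4 := _ + \sum_(n < N) _ * tail X (t - (_ + 0)).
set p1 := pr _; set p2 := pr _; set p := tail (X \+ Y) t.
set r := tail X _ * _; set q := (t ^+ 2)^-1.
move: s1 s2 s3 s4 p1 p2 p r q => s1 s2 s3 s4 p1 p2 p r q.
rewrite !ler_norml => hr /andP[? ?] /andP[? ?] /andP[? ?] /andP[? ?] ? ? ? ? ? ?.
by apply/andP; split; lra.
Qed.

End convolution_expansion.

(** * Sums of many independent variables *)

Section independence_of_sums.
Variables (R : realType) (d : measure_display) (Omega : measurableType d).
Variable P : probability Omega R.

(* Independence of an event from the pair (U, V) only has to be checked on
   rectangles, which form a pi-system. *)
Lemma independent_event_pair (U V : Omega -> R) (E : set Omega) :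
  measurable_fun setT U -> measurable_fun setT V -> measurable E ->
  (forall A B : set R, measurable A -> measurable B ->
    P (U @^-1` A `&` V @^-1` B `&` E) = (P (U @^-1` A `&` V @^-1` B) * P E)%E) ->
  forall C : set (R * R), measurable C ->
  P ((fun o => (U o, V o)) @^-1` C `&` E) = (P ((fun o => (U o, V o)) @^-1` C) * P E)%E.
Proof.
move=> mU mV mE H C mC; pose h o := (U o, V o).
have mh : measurable_fun setT h by exact: measurable_fun_pair.
have mpre (D : set (R * R)) : measurable D -> measurable (h @^-1` D).
  by move=> mD; rewrite -[_ @^-1` _]setTI; exact: mh.
rewrite -/h; move: C mC; rewrite measurable_prod_measurableType.
apply: dynkin_induction.
- by rewrite measurable_prod_measurableType.
- move=> _ _ [A1 mA1 [A2 mA2 <-]] [B1 mB1 [B2 mB2 <-]].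
  exists (A1 `&` B1); first exact: measurableI.
  by exists (A2 `&` B2); [exact: measurableI|rewrite setXI].
- by rewrite preimage_setT setTI probability_setT mul1e.
- by move=> _ [A mA [B mB <-]]; rewrite (_ : h @^-1` _ = U @^-1` A `&` V @^-1` B)// H.
- move=> S mS; have mhS := mpre _ mS.
  have mhSE := measurableI _ _ mhS mE.
  have mC := measurableC mhS; have mCE := measurableI _ _ mC mE.
  rewrite preimage_setC !(prE P)// -!EFinM => -[e]; congr EFin.
  have := pr_split P mE mhS; rewrite ![E `&` _]setIC e.
  have := pr_split P measurableT mhS; rewrite !setTI pr_setT.
  move=> e1 e2; have -> : prob P (~` (h @^-1` S)) = 1 - prob P (h @^-1` S) by lra.
  by lra.
- move=> F mF tF IH; rewrite preimage_bigcup setI_bigcupl.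
  have tF' : trivIset [set: nat] (fun n => h @^-1` F n).
    apply/trivIsetP => i j _ _ ij; rewrite -preimage_setI.
    by move/trivIsetP : tF => /(_ _ _ _ _ ij) ->//; rewrite preimage_set0.
  rewrite !measure_semi_bigcup//; last 5 first.
  + by move=> n; exact: mpre.
  + by apply: bigcup_measurable => n _; exact: mpre.
  + by move=> n; apply: measurableI => //; exact: mpre.
  + apply/trivIsetP => i j _ _ ij; rewrite setIACA.
    by move/trivIsetP : tF' => /(_ _ _ _ _ ij) ->//; rewrite set0I.
  + by apply: bigcup_measurable => n _; apply: measurableI => //; exact: mpre.
  rewrite [in RHS](prE P mE) muleC -nneseriesZl//.
  by apply: eq_eseriesr => n _; have /= -> := IH n; rewrite [in LHS](prE P mE) muleC.
Qed.

Variables (I : finType) (X : I -> {RV P >-> R}).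
Hypothesis indX : independent_RVs X.

Let event (J : {set I}) (B : I -> set R) := [set o | forall i, i \in J -> B i (X i o)].

Let measurable_event J B : (forall i, measurable (B i)) -> measurable (event J B).
Proof.
move=> mB; rewrite /event (_ : mkset _ = \bigcap_(i in [set i | i \in J]) (X i @^-1` B i)).
  by apply: fin_bigcap_measurable => // i _; exact: measurable_funPTI.
by apply/seteqP; split => o /= h i; exact: h.
Qed.

Variable w : I -> R.
Let lin s o := \sum_(j <- s) w j * X j o.

Lemma measurable_lin_comb (s : seq I) :
  measurable_fun setT (fun o => \sum_(j <- s) w j * X j o).
Proof.
apply: measurable_sum => j; apply: measurable_funM => //.
Qed.

(** Induction peels [X k] off the combination. The pair of [X k] and the shorter sum is tested on
    rectangles, where the condition on [X k] is one more coordinate condition; hence the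
    quantification over [J] and [B]. *)
Lemma independent_lin_comb_event (s : seq I) (J : {set I}) (A : set R) B :
  uniq s -> {in s, forall j, j \notin J} -> measurable A -> (forall i, measurable (B i)) ->
  P (lin s @^-1` A `&` event J B) = (P (lin s @^-1` A) * P (event J B))%E.
Proof.
elim: s J A B => [|k s IH] J A B.
  move=> _ _ mA mB.
  have [A0|A0] := pselect (A 0).
    rewrite (_ : lin [::] @^-1` A = setT) ?setTI ?probability_setT ?mul1e//.
    by apply/seteqP; split => o //= _; rewrite /lin big_nil.
  rewrite (_ : lin [::] @^-1` A = set0) ?set0I ?measure0 ?mul0e//.
  by apply/seteqP; split => o //=; rewrite /lin big_nil.
move=> /= /andP[ks us] ksJ mA mB.
have kJ : k \notin J by apply: ksJ; rewrite inE eqxx.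
have sJ j : j \in s -> j \notin J by move=> js; apply: ksJ; rewrite inE js orbT.
pose f (z : R * R) := w k * z.1 + z.2.
have mf : measurable_fun setT f.
  apply: measurable_funD => //.
  by apply: measurable_funM.
have -> : lin (k :: s) @^-1` A = (fun o => (X k o, lin s o)) @^-1` (f @^-1` A).
  by apply/seteqP; split => o /=; rewrite /lin big_cons.
have event1 (D : set R) : event [set k] (fun=> D) = X k @^-1` D.
  by apply/seteqP; split => o /=; [apply; rewrite inE|move=> h i; rewrite inE => /eqP ->].
apply: independent_event_pair.
- exact: measurable_funPT.
- exact: measurable_lin_comb.
- exact: measurable_event.
- move=> C D mC mD.
  have -> : X k @^-1` C `&` lin s @^-1` D = lin s @^-1` D `&` event [set k] (fun=> C).
    by rewrite setIC event1.
  rewrite IH//; last first.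
    by move=> j js; rewrite inE; apply: contraNneq ks => <-.
  (* Merges the condition on [X k] into the family; as [k] is not in [J], no condition of [B] on [J]
     is overwritten. *)
  pose B' i := if i == k then C else B i.
  have mB' i : measurable (B' i) by rewrite /B'; case: ifP.
  have -> : lin s @^-1` D `&` event [set k] (fun=> C) `&` event J B =
            lin s @^-1` D `&` event (k |: J) B'.
    rewrite -setIA; congr (_ `&` _); rewrite event1; apply/seteqP; split => o /=.
      move=> [hk hJ] i; rewrite !inE /B'; case: eqP => [->//|_] /=; exact: hJ.
    move=> h; split; first by have := h k; rewrite /B' eqxx; apply; rewrite !inE eqxx.
    move=> i iJ; have := h i; rewrite !inE iJ orbT /B' => /(_ isT).
    by case: eqP => // ik; move: kJ; rewrite -ik iJ.
  rewrite IH//; last first.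
    move=> j js; rewrite !inE negb_or sJ// andbT.
    by apply: contraNneq ks => <-.
  rewrite -muleA; congr (_ * _)%E.
  rewrite event1 !indX// big_setU1//= {1}/B' eqxx; congr (_ * _)%E.
  apply: eq_bigr => i iJ; rewrite /B'; case: eqP => // ik.
  by move: kJ; rewrite -ik iJ.
- by rewrite -[_ @^-1` _]setTI; exact: mf.
Qed.

Lemma independent_lin_comb (s : seq I) (i : I) : i \notin s -> uniq s ->
  independent2 P (X i) (fun o => \sum_(j <- s) w j * X j o).
Proof.
move=> si us B C mB mC.
have := @independent_lin_comb_event s [set i] C (fun=> B) us.
have -> : event [set i] (fun=> B) = X i @^-1` B.
  by apply/seteqP; split => o /=; [apply; rewrite inE|move=> h j; rewrite inE => /eqP ->].
by rewrite setIC muleC; apply => // j js; rewrite inE; apply: contraNneq si => <-.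
Qed.

End independence_of_sums.

(** * Weighted sums and Landau forms *)

Section weighted_sums.
Variables (R : realType) (d : measure_display) (Omega : measurableType d).
Variable P : probability Omega R.
Local Notation pr := (prob P).
Local Notation tail := (survival P).

Lemma measurable_lt (X : Omega -> R) t : measurable_fun setT X ->
  measurable [set o | X o < t].
Proof.
move=> mX; rewrite (_ : [set o | X o < t] = [set o | - t < - X o]).
  by apply: measurable_gt; exact: measurable_funN.
by apply/seteqP; split => o /=; rewrite ltrN2.
Qed.

Lemma pr_subset0 A B : measurable A -> measurable B -> A `<=` B -> pr B = 0 -> pr A = 0.
Proof.
move=> mA mB AB B0; apply/eqP; rewrite eq_le pr_ge0 andbT -B0.
exact: le_pr.
Qed.

Lemma pr_scale_lt0 (X : Omega -> R) w : measurable_fun setT X -> 0 <= w ->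
  pr [set o | X o < 0] = 0 -> pr [set o | w * X o < 0] = 0.
Proof.
move=> mX w0; apply: pr_subset0.
- by apply: measurable_lt; exact: measurable_funM.
- exact: measurable_lt.
- by move=> o /=; apply: contraTT; rewrite -!leNgt => /(mulr_ge0 w0).
Qed.

Lemma pr_add_lt0 (X Y : Omega -> R) : measurable_fun setT X -> measurable_fun setT Y ->
  pr [set o | X o < 0] = 0 -> pr [set o | Y o < 0] = 0 ->
  pr [set o | X o + Y o < 0] = 0.
Proof.
move=> mX mY X0 Y0; have mX0 := measurable_lt 0 mX; have mY0 := measurable_lt 0 mY.
apply: (@pr_subset0 _ ([set o | X o < 0] `|` [set o | Y o < 0])).
- by apply: measurable_lt; exact: measurable_funD.
- exact: measurableU.
- move=> o /= h; case: (ltP (X o) 0) => hX; first by left.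
  by right; lra.
- by apply/eqP; rewrite eq_le pr_ge0 andbT; apply: le_trans (prU_le P mX0 mY0) _;
    rewrite X0 Y0 addr0.
Qed.

(** The tail of [w * X] at [x] is that of [X] at [x / w]; [w <= 1] keeps this point in the range of
    the expansion and shrinks the remainder. *)
Lemma tail_expansion_scale (X : Omega -> R) c w : measurable_fun setT X ->
  tail_expansion c 0 (tail X) -> 0 <= w -> w <= 1 ->
  tail_expansion (c * w) 0 (tail (fun o => w * X o)).
Proof.
move=> mX [K K0 H] w0 w1; exists K => // x x1.
have x0 : 0 < x by lra.
(* For [w = 0] the scaled variable is constantly 0 and its tail vanishes at [x >= 1]; the change of
   variable [x / w] is reserved for [w > 0]. *)
have [->|wn0] := eqVneq w 0.
  rewrite /survival (_ : [set o | _] = set0); last first.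
    by apply/seteqP; split => o //=; rewrite mul0r; lra.
  rewrite /prob measure0/= mulr0 !mul0r addr0 subr0 normr0 divr_ge0 ?sqr_ge0//.
have {wn0}w0 : 0 < w by rewrite lt_neqAle eq_sym wn0.
have -> : tail (fun o => w * X o) x = tail X (x / w).
  congr pr; apply/seteqP; split => o /=; by rewrite ltr_pdivrMr// mulrC.
have xw : 1 <= x / w by rewrite ler_pdivlMr//; lra.
have := H _ xw; rewrite !mul0r !addr0 invf_div mulrA => /le_trans; apply.
have xxw : x <= x / w by rewrite ler_pdivlMr// ler_piMr// ltW.
have x2 : x ^+ 2 <= (x / w) ^+ 2 by rewrite lerXn2r ?nnegrE//; lra.
by apply: ler_wpM2l => //; rewrite lef_pV2 ?posrE ?exprn_gt0//; lra.
Qed.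

Lemma independent2_scale (X Y : Omega -> R) w : independent2 P X Y ->
  independent2 P (fun o => w * X o) Y.
Proof.
move=> XY C D mC mD.
have mC' : measurable ((fun x => w * x) @^-1` C).
  rewrite -[_ @^-1` _]setTI.
  exact: (measurable_funM (@measurable_cst _ _ _ _ setT w)
    (@measurable_id _ _ setT)).
exact: XY mC' mD.
Qed.

(** Up to the factor [c ^+ 2], the right side has the form [b + b' + 2 * (a * a')] with [b = 0] that
    [tail_expansionD] delivers. *)
Lemma sqr_sum_sub_sum_sqr_cons (I : Type) (w : I -> R) i s :
  (\sum_(j <- i :: s) w j) ^+ 2 - \sum_(j <- i :: s) w j ^+ 2 =
  0 + ((\sum_(j <- s) w j) ^+ 2 - \sum_(j <- s) w j ^+ 2) + 2 * (w i * \sum_(j <- s) w j).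
Proof. by rewrite !big_cons; ring. Qed.

(** The nullity of the negative part travels through the induction with the expansion because
    [tail_expansionD] asks for it of both summands. *)
Lemma tail_expansion_weighted_sum (I : finType) (X : I -> {RV P >-> R}) (w : I -> R) c s :
  independent_RVs X -> 0 <= c ->
  (forall i, tail_expansion c 0 (tail (X i))) ->
  (forall i, pr [set o | X i o < 0] = 0) ->
  (forall i, 0 <= w i <= 1) -> uniq s ->
  pr [set o | \sum_(j <- s) w j * X j o < 0] = 0 /\
  tail_expansion (c * \sum_(j <- s) w j)
    (c ^+ 2 * ((\sum_(j <- s) w j) ^+ 2 - \sum_(j <- s) w j ^+ 2))
    (tail (fun o => \sum_(j <- s) w j * X j o)).
Proof.
move=> indX c0 HX X0 w01.
have B0 t : 0 <= (\sum_(j <- t) w j) ^+ 2 - \sum_(j <- t) w j ^+ 2.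
  elim: t => [|i t IH]; first by rewrite !big_nil expr0n/= subrr.
  rewrite sqr_sum_sub_sum_sqr_cons add0r addr_ge0// mulr_ge0// mulr_ge0//.
    by have /andP[] := w01 i.
  by apply: sumr_ge0 => j _; have /andP[] := w01 j.
elim: s => [_|i s IH /= /andP[is' us]].
  split.
    rewrite (_ : [set o | _] = set0) ?/prob ?measure0//.
    by apply/seteqP; split => o //=; rewrite big_nil ltxx.
  exists 0 => // x x1.
  rewrite /survival (_ : [set o | _] = set0); last first.
    by apply/seteqP; split => o //=; rewrite big_nil; lra.
  by rewrite /prob measure0/= !big_nil expr0n/= subrr !mulr0 !mul0r addr0 subrr normr0.
have [S0 HS] := IH us.
have mXi : measurable_fun setT (X i) by exact: measurable_funPT.
have mwX : measurable_fun setT (fun o => w i * X i o).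
  exact: measurable_funM.
have mS : measurable_fun setT (fun o => \sum_(j <- s) w j * X j o).
  exact: measurable_lin_comb.
have eS : (fun o => \sum_(j <- i :: s) w j * X j o) =
    (fun o => w i * X i o) \+ (fun o => \sum_(j <- s) w j * X j o).
  by apply/funext => o; rewrite big_cons.
have /andP[wi0 wi1] := w01 i.
split.
  rewrite (_ : [set o | _] = [set o | w i * X i o + \sum_(j <- s) w j * X j o < 0]).
    by apply: pr_add_lt0 => //; exact: pr_scale_lt0.
  by apply/seteqP; split => o /=; rewrite big_cons.
rewrite eS sqr_sum_sub_sum_sqr_cons.
have -> : c ^+ 2 * (0 + ((\sum_(j <- s) w j) ^+ 2 - \sum_(j <- s) w j ^+ 2) +
    2 * (w i * \sum_(j <- s) w j)) =
  0 + c ^+ 2 * ((\sum_(j <- s) w j) ^+ 2 - \sum_(j <- s) w j ^+ 2) +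
  2 * ((c * w i) * (c * \sum_(j <- s) w j)) by ring.
rewrite big_cons mulrDr.
apply: tail_expansionD => //.
- by apply: independent2_scale; exact: independent_lin_comb.
- exact: pr_scale_lt0.
- exact: mulr_ge0.
- by apply: mulr_ge0 => //; apply: sumr_ge0 => j _; have /andP[] := w01 j.
- by rewrite mulr_ge0 ?sqr_ge0.
- exact: tail_expansion_scale.
Qed.

Lemma sum_mul_lt_ord m (w : 'I_m -> R) :
  2 * (\sum_(i < m) \sum_(j < m | (i < j)%N) w i * w j) =
  (\sum_(i < m) w i) ^+ 2 - \sum_(i < m) w i ^+ 2.
Proof.
have -> : (\sum_(i < m) w i) ^+ 2 = \sum_(i < m) \sum_(j < m) w i * w j.
  by rewrite expr2 big_distrlr.
have e1 : \sum_(i < m) \sum_(j < m) w i * w j =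
  \sum_(i < m) \sum_(j < m | (i < j)%N) w i * w j +
  \sum_(i < m) \sum_(j < m | (j < i)%N) w i * w j + \sum_(i < m) w i ^+ 2.
  rewrite -!big_split/=; apply: eq_bigr => i _.
  rewrite (bigID (fun j : 'I_m => (i < j)%N))/= -addrA; congr (_ + _).
  rewrite (bigID (fun j : 'I_m => (j < i)%N))/=; congr (_ + _).
    by apply: eq_bigl => j; rewrite -leqNgt ltn_neqAle andbC; case: (ltngtP j i).
  rewrite (big_pred1 i) ?expr2// => j.
  by rewrite -!leqNgt -eqn_leq eq_sym.
have e2 : \sum_(i < m) \sum_(j < m | (j < i)%N) w i * w j =
  \sum_(i < m) \sum_(j < m | (i < j)%N) w i * w j.
  rewrite (exchange_big_dep xpredT)//=; apply: eq_bigr => i _.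
  by apply: eq_bigr => j _; rewrite mulrC.
by rewrite e1 e2 addrK mulrDl mul1r.
Qed.

Lemma tail_expansion_simplex m (X : 'I_m -> {RV P >-> R}) (w : 'I_m -> R) c :
  simplex_weights w -> independent_RVs X -> 0 <= c ->
  (forall i, tail_expansion c 0 (tail (X i))) ->
  (forall i, pr [set o | X i o < 0] = 0) ->
  tail_expansion c (2 * c ^+ 2 * (\sum_(i < m) \sum_(j < m | (i < j)%N) w i * w j))
    (fun t => fine (P [set o | t < \sum_(i < m) w i * X i o])).
Proof.
move=> [w0 w1] indX c0 HX X0.
have w01 i : 0 <= w i <= 1.
  rewrite w0/= -w1 (bigD1 i)//= lerDl; exact: sumr_ge0.
have [_] := tail_expansion_weighted_sum indX c0 HX X0 w01 (index_enum_uniq 'I_m).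
by rewrite w1 mulr1 -[in X in tail_expansion _ X _]w1 -sum_mul_lt_ord mulrA (mulrC _ 2).
Qed.

Lemma tail_expansion_bigO a b (F : R -> R) : tail_expansion a b F ->
  F = (fun t : R => a / t + b * (ln t / t ^+ 2)) +O_ (+oo%R) (fun t : R => t ^- 2).
Proof.
move=> [K K0 H]; apply/eqaddOP; exists K; split; first exact: num_real.
move=> k Kk; exists 1; split; first exact: num_real.
move=> t t1; apply: le_trans (H t (ltW t1)) _.
rewrite ger0_norm ?invr_ge0 ?sqr_ge0//.
by rewrite ler_wpM2r ?invr_ge0 ?sqr_ge0// ltW.
Qed.

(** Comparing the two estimates would bound [b * ln t] by a constant for all large [t]. *)
Lemma tail_expansion_not_bigO a b (F : R -> R) : 0 < b -> tail_expansion a b F ->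
  ~ (F = (fun t : R => a / t) +O_ (+oo%R) (fun t : R => t ^- 2)).
Proof.
move=> b0 [K K0 H] /eqaddOP [k0 [_ /(_ (k0 + 1))]].
rewrite ltrDl ltr01 => /(_ isT) [T [_ HT]].
(* Chosen so that [t > T], [t >= 1] and [b * ln t >= K + k + 1], more than the two error bounds
   together allow. *)
pose k := k0 + 1; pose t := expR ((K + k + 1) / b) + `|T| + 1.
have e0 : 0 < expR ((K + k + 1) / b) by rewrite expR_gt0.
have T0 : T <= `|T| by exact: ler_norm.
have T00 : 0 <= `|T| by [].
have Tt : T < t by rewrite /t; lra.
have t1 : 1 <= t by rewrite /t; lra.
have t0 : 0 < t by lra.
have lt : (K + k + 1) / b <= ln t.
  by rewrite -[leLHS]expRK ler_ln ?posrE// /t; lra.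
have q0 : 0 < (t ^+ 2)^-1 by rewrite invr_gt0 exprn_gt0.
have := HT t Tt; have := H t t1.
have -> : (F - (fun t : R => a / t)) t = F t - a / t by [].
rewrite (gtr0_norm q0) !ler_norml -/k => /andP[h1 h2] /andP[h3 h4].
move: lt; rewrite ler_pdivrMr// => lt.
have := ler_wpM2r (ltW q0) lt; move: (ln t) h1 h2 => l h1 h2.
lra.
Qed.

End weighted_sums.

(** * Existence of independent pairs with a given distribution function *)

Section iid_pair.
Variable R : realType.

Section from_cdf.
Variable f : cumulativeBounded (0 : R) (1 : R).
Let mu := lebesgue_stieltjes_measure f.
Let T := measurableTypeR R.
Let P := (mu \x mu)%E.
Let coord (i : 'I_2) : T * T -> R := fun z => if i == ord0 then z.1 else z.2.

Let measurable_coord i : measurable_fun setT (coord i).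
Proof.
by rewrite /coord; case: (i == ord0); [exact: measurable_fst|exact: measurable_snd].
Qed.

HB.instance Definition _ i := isMeasurableFun.Build _ _ (T * T)%type R (coord i)
  (measurable_coord i).

Let X (i : 'I_2) : {RV P >-> R} := coord i.

Let pr_coord i (A : set R) : measurable A -> P (X i @^-1` A) = mu A.
Proof.
move=> mA; rewrite (_ : _ @^-1` _ = [set z | A (if i == ord0 then z.1 else z.2)])//.
case: (i == ord0).
  rewrite (_ : [set _ | _] = A `*` setT); last first.
    by apply/seteqP; split => z /=; [move=> ?; split|case].
  by rewrite /P product_measure1E// [X in (_ * X)%E]probability_setT mule1.
rewrite (_ : [set _ | _] = setT `*` A); last first.
  by apply/seteqP; split => z /=; [move=> ?; split|case].
by rewrite /P product_measure1E// [X in (X * _)%E]probability_setT mul1e.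
Qed.

Let independent_coord : independent_RVs X.
Proof.
move=> J B mB.
(* Padding with [setT] outside [J] turns the event of a subfamily into a full rectangle. *)
pose A i := if i \in J then B i else setT.
have mA i : measurable (A i) by rewrite /A; case: ifP.
rewrite (_ : [set z | _] = A ord0 `*` A ord_max); last first.
  apply/seteqP; split => z /=.
    by move=> h; split; rewrite /A; case: ifP => // /h; rewrite /X /coord.
  move=> [h0 h1] i iJ; rewrite /X /coord; case: eqP => i0.
    by move: h0; rewrite /A -i0 iJ.
  have im : i = ord_max.
    by apply/val_inj; case: i i0 {iJ} => [[|[|//]]] //= ? i0; case: i0; exact/val_inj.
  by move: h1; rewrite /A -im iJ.
rewrite -[LHS]/((mu \x mu)%E (A ord0 `*` A ord_max)).
rewrite product_measure1E; [|exact: mA..].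
rewrite big_mkcond/= big_ord_recl big_ord1.
have e i : (if i \in J then P (X i @^-1` B i) else 1%E) = mu (A i).
  by rewrite /A; case: ifP => _; [exact: pr_coord|rewrite [RHS]probability_setT].
by rewrite !e; congr (_ * mu (A _))%E; exact/val_inj.
Qed.

(** The witnesses are the coordinates of the plane under the product of the Stieltjes measure with
    itself. Refuting the improved rates requires such actual variables. *)
Lemma exists_iid_pair_of_cdf :
  exists (d : measure_display) (Omega : measurableType d) (P : probability Omega R)
    (X : 'I_2 -> {RV P >-> R}),
  independent_RVs X /\ forall i y, ccdf (X i) y = (1 - f y)%:E.
Proof.
exists _, (T * T)%type, P, X; split; first exact: independent_coord.
move=> i y; rewrite ccdf_1_cdf EFinB -(cdf_lebesgue_stieltjes_id f).
by congr (_ - _)%E; exact: pr_coord.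
Qed.

End from_cdf.

Lemma exists_iid_pair (f : R -> R) :
  {homo f : x y / x <= y} -> continuous f ->
  (forall x, x <= 0 -> f x = 0) -> f x @[x --> +oo] --> (1 : R) ->
  exists (d : measure_display) (Omega : measurableType d) (P : probability Omega R)
    (X : 'I_2 -> {RV P >-> R}),
  independent_RVs X /\ forall i y, ccdf (X i) y = (1 - f y)%:E.
Proof.
move=> ndf cf f0 f1.
have rcf : right_continuous f.
  by move=> x; have /left_right_continuousP[] := cf x.
have fNy : f x @[x --> -oo] --> (0 : R).
  by apply: cvg_near_cst; exists 0; split => // x /ltW/f0.
pose g := [the cumulativeBounded (0 : R) (1 : R) of
  HB.pack_for (cumulativeBounded (0 : R) (1 : R)) f
    (isCumulative.Build R _ R f ndf rcf) (isCumulativeBounded.Build R 0 1 f fNy f1)].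
exact: (exists_iid_pair_of_cdf g).
Qed.

Lemma exists_pareto_pair :
  exists (d : measure_display) (Omega : measurableType d) (P : probability Omega R)
    (Y : 'I_2 -> {RV P >-> R}),
  independent_RVs Y /\ forall i, standard_pareto (Y i).
Proof.
have max0 (x : R) : 0 < Num.max x 1 by rewrite lt_max ltr01 orbT.
(* The maximum extends the distribution function by 0 below the support, continuously at 1. *)
case: (@exists_iid_pair (fun y => 1 - (Num.max y 1)^-1)).
- move=> x y xy; rewrite lerD2l lerN2 lef_pV2 ?posrE//.
  by rewrite ge_max !le_max xy lexx orbT.
- move=> x; apply: cvgB; first exact: cvg_cst.
  apply: cvgV; first exact: lt0r_neq0.
  by apply: continuous_max => //; exact: cvg_cst.
- by move=> x x0; rewrite max_r ?invr1 ?subrr//; lra.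
- rewrite -[X in _ --> X]subr0; apply: cvgB; first exact: cvg_cst.
  apply: (gtr0_cvgV0 (f := fun y : R => Num.max y 1) _).2; first by apply: nearW.
  apply: cvg_trans (@cvg_id _ (pinfty_nbhs R)); apply: near_eq_cvg.
  by exists 1; split => // x x1; rewrite max_l// ltW.
move=> d [T [P [Y [indY HY]]]]; exists d, T, P, Y; split => // i y y1.
by rewrite HY max_l// opprB addrC subrK.
Qed.

(** Complementary angles have reciprocal tangents. This turns the distribution function
    [2 / pi * atan x] into the prescribed tail. *)
Lemma atan_inv (x : R) : 0 < x -> atan (1 / x) = pi / 2 - atan x.
Proof.
move=> x0; have a0 : 0 < atan x by rewrite -[ltLHS]atan0 lt_atan.
have a1 := atan_ltpi2 x.
have p0 := pi_gt0 R.
rewrite -[RHS]tanK ?in_itv/=; last by apply/andP; split; lra.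
congr atan; have e : sin (pi / 2 - atan x) = cos (atan x).
  by rewrite sinB sin_pihalf cos_pihalf mul1r mul0r subr0.
have e' : cos (pi / 2 - atan x) = sin (atan x).
  by rewrite cosB sin_pihalf cos_pihalf mul1r mul0r add0r.
by rewrite /tan e e' -[in LHS](atanK x) /tan div1r invf_div.
Qed.

Lemma mulr_pihalf : 2 / pi * (pi / 2) = 1 :> R.
Proof. by rewrite mulrA divfK ?lt0r_neq0 ?pi_gt0// divff// pnatr_eq0. Qed.

Lemma exists_half_cauchy_pair :
  exists (d : measure_display) (Omega : measurableType d) (P : probability Omega R)
    (H : 'I_2 -> {RV P >-> R}),
  independent_RVs H /\ forall i, standard_half_cauchy (H i).
Proof.
have p0 := pi_gt0 R.
case: (@exists_iid_pair (fun y => 2 / pi * atan (Num.max y 0))).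
- move=> x y xy; apply: ler_wpM2l; first by rewrite divr_ge0// ltW.
  by apply: le_atan; rewrite ge_max !le_max xy lexx orbT.
- move=> x; apply: cvgM; first exact: cvg_cst.
  apply: (continuous_comp (f := fun y : R => Num.max y 0)); last exact: continuous_atan.
  by apply: continuous_max => //; exact: cvg_cst.
- by move=> x x0; rewrite max_r// atan0 mulr0.
- rewrite -[X in _ --> X]mulr_pihalf.
  apply: cvgM; first exact: cvg_cst.
  apply: cvg_trans; last exact: cvgy_atan.
  apply: near_eq_cvg.
  by exists 0; split => // x x1; rewrite max_l// ltW.
move=> d [T [P [Y [indY HY]]]]; exists d, T, P, Y; split => // i x x0.
by rewrite HY max_l ?ltW// atan_inv// mulrBr mulr_pihalf.
Qed.

End iid_pair.

(** * The exact identity for two Pareto variables *)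

Section exact_identity.
Variable R : realType.

(** Over [n] equal steps the increments add up to at most [C * (b - a) ^+ 2 / n], which is
    arbitrarily small. *)
Lemma quadratic_increments_const (f : R -> R) a b C : a <= b ->
  (forall x y, a <= x -> x <= y -> y <= b -> `|f y - f x| <= C * (y - x) ^+ 2) ->
  f a = f b.
Proof.
move=> ab H; apply/eqP; rewrite eq_sym -subr_eq0 -normr_le0 leNgt; apply/negP => e0.
have C0 : 0 <= C * (b - a) ^+ 2 by apply: le_trans (H a b _ _ _).
(* The successor of the integer part makes [C * (b - a) ^+ 2 / n] strictly smaller than the supposed
   gap. *)
pose n := (Num.trunc (C * (b - a) ^+ 2 / `|f b - f a|)).+1.
have n0 : 0 < n%:R :> R by rewrite ltr0n.
have ndef : C * (b - a) ^+ 2 < n%:R * `|f b - f a|.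
  by rewrite -ltr_pdivrMr//; exact: truncnS_gt.
pose x (i : nat) := a + (b - a) * (i%:R / n%:R).
have bound i : (i <= n)%N -> `|f (x i) - f a| <= i%:R * (C * ((b - a) / n%:R) ^+ 2).
  elim: i => [|i IH] ni.
    by rewrite /x !mul0r mulr0 addr0 subrr normr0.
  have step : x i.+1 - x i = (b - a) / n%:R.
    by rewrite /x -(natr1 i); field; rewrite gt_eqF.
  have h0 : 0 <= (b - a) / n%:R by rewrite divr_ge0 ?subr_ge0// ltW.
  rewrite -(subrK (f (x i)) (f (x i.+1))) -addrA.
  apply: le_trans (ler_normD _ _) _.
  rewrite -(natr1 i) mulrDl mul1r [leRHS]addrC; apply: lerD; last exact/IH/ltnW.
  rewrite -step; apply: H.
  - by rewrite /x lerDl mulr_ge0 ?subr_ge0// divr_ge0// ltW.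
  - by rewrite -subr_ge0 step.
  - rewrite /x -lerBrDl ler_piMr ?subr_ge0// ler_pdivrMr// mul1r ler_nat//.
have := bound n (leqnn _).
have -> : x n = b by rewrite /x divff ?gt_eqF// mulr1 subrKC.
have -> : n%:R * (C * ((b - a) / n%:R) ^+ 2) = C * (b - a) ^+ 2 / n%:R.
  by field; rewrite gt_eqF.
rewrite ler_pdivlMr// mulrC => /le_lt_trans/(_ ndef).
by rewrite ltxx.
Qed.

(* Antiderivative in s of (p / s ^ 2) * (q / (t - s)): the density of a
   Pareto tail p / s against the Pareto tail q / (t - s). *)
Definition pareto_primitive (p q t s : R) :=
  p * q * (- (1 / (t * s)) + (ln s - ln (t - s)) / t ^+ 2).

(** [g] stands for the probability that the sum exceeds [t] while [s < Y <= s']; its two bounds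
    freeze the tail of [X] at either end. Logarithm bounds place the increment of the primitive in
    the same range up to a quadratic error. *)
Lemma pareto_primitive_increment p q t : 0 < p -> 0 < q -> p + q < t ->
  exists C, forall s s', p <= s -> s <= s' -> s' <= t - q -> forall g,
  (p / s - p / s') * (q / (t - s)) <= g ->
  g <= (p / s - p / s') * (q / (t - s')) ->
  `|g - (pareto_primitive p q t s' - pareto_primitive p q t s)| <= C * (s' - s) ^+ 2.
Proof.
move=> p0 q0 pqt; have t0 : 0 < t by lra.
pose A := p^-1; pose B := q^-1; pose T := t^-1.
exists (p * q * (A ^+ 2 * B ^+ 2 + A ^+ 3 * B + T * A ^+ 3 + T ^+ 2 * A ^+ 2 + T ^+ 2 * B ^+ 2)).
move=> s s' ps ss' s't g.
have s0 : 0 < s by lra.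
have s'0 : 0 < s' by lra.
have r0 : 0 < t - s by lra.
have r'0 : 0 < t - s' by lra.
have /andP[l1 l2] := ln_ratio_bounds s0 s'0.
have /andP[l3 l4] := ln_ratio_bounds r'0 r0.
have hE : t - s - (t - s') = s' - s by ring.
rewrite hE in l3 l4.
have u0 : 0 < s^-1 by rewrite invr_gt0.
have u'0 : 0 < s'^-1 by rewrite invr_gt0.
have v0 : 0 < (t - s)^-1 by rewrite invr_gt0.
have v'0 : 0 < (t - s')^-1 by rewrite invr_gt0.
have T0 : 0 < T by rewrite invr_gt0.
have uA : s^-1 <= A by rewrite lef_pV2.
have u'A : s'^-1 <= A by rewrite lef_pV2// ?posrE//; lra.
have vB : (t - s)^-1 <= B by rewrite lef_pV2 ?posrE//; lra.
have v'B : (t - s')^-1 <= B by rewrite lef_pV2 ?posrE//; lra.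
have eu : s^-1 - s'^-1 = (s' - s) * s^-1 * s'^-1 by field; rewrite !gt_eqF.
have ev : (t - s')^-1 - (t - s)^-1 = (s' - s) * (t - s)^-1 * (t - s')^-1.
  by field; rewrite !gt_eqF.
(* Partial fractions of the integrand; this identity cancels the terms of order 0 in [eup] and
   [elo]. *)
have eI : s^-1 * s^-1 * (t - s)^-1 =
    T * s^-1 * s^-1 + T ^+ 2 * (s^-1 + (t - s)^-1).
  by rewrite /T; field; rewrite !gt_eqF.
have ePhi : pareto_primitive p q t s' - pareto_primitive p q t s =
  p * q * (T * (s^-1 - s'^-1) +
    T ^+ 2 * ((ln s' - ln s) + (ln (t - s) - ln (t - s')))).
  rewrite /pareto_primitive /T; field; rewrite !gt_eqF//.
rewrite ePhi {ePhi}.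
have h0 : 0 <= s' - s by lra.
have pq0 : 0 < p * q by rewrite mulr_gt0.
have eG1 : (p / s - p / s') * (q / (t - s)) = p * q * ((s^-1 - s'^-1) * (t - s)^-1) by ring.
have eG2 : (p / s - p / s') * (q / (t - s')) = p * q * ((s^-1 - s'^-1) * (t - s')^-1) by ring.
rewrite eG1 eG2 {eG1 eG2}.
move: (ln s' - ln s) l1 l2 => L1 l1 l2.
move: (ln (t - s) - ln (t - s')) l3 l4 => L2 l3 l4.
have A0 : 0 < A by rewrite invr_gt0.
have B0 : 0 < B by rewrite invr_gt0.
move: A B T (s^-1) (s'^-1) ((t - s)^-1) ((t - s')^-1) (s' - s) A0 B0 u0 u'0 v0 v'0 T0 uA u'A vB v'B eu ev eI h0 l1 l2 l3 l4.
move=> {hE} A B T u u' v v' h A0 B0 u0 u'0 v0 v'0 T0 uA u'A vB v'B eu ev eI h0 l1 l2 l3 l4 g1 g2.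
(* After division by [p * q * h], [eup] and [elo] compute the extreme gaps above and below; the
   factor [h] left in each makes the error quadratic. *)
have eup : u * u' * v' - T * u * u' - T ^+ 2 * (u' + v) =
    h * (u ^+ 2 * (v * v') - u ^+ 2 * u' * v' + T * (u ^+ 2 * u') + T ^+ 2 * (u * u')).
  have -> : u * u' * v' - T * u * u' - T ^+ 2 * (u' + v) =
    (u * u * v - T * u * u - T ^+ 2 * (u + v)) - u * v' * (u - u') + u ^+ 2 * (v' - v)
    + T * u * (u - u') + T ^+ 2 * (u - u') by ring.
  by rewrite eu ev eI; ring.
have elo : u * u' * v - T * u * u' - T ^+ 2 * (u + v') =
    h * (- (u ^+ 2 * u' * v) + T * (u ^+ 2 * u') - T ^+ 2 * (v * v')).
  have -> : u * u' * v - T * u * u' - T ^+ 2 * (u + v') =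
    (u * u * v - T * u * u - T ^+ 2 * (u + v)) - u * v * (u - u')
    + T * u * (u - u') - T ^+ 2 * (v' - v) by ring.
  by rewrite eu ev eI; ring.
have u00 := ltW u0; have u'00 := ltW u'0; have v00 := ltW v0; have v'00 := ltW v'0.
have A00 := ltW A0; have B00 := ltW B0; have T00 := ltW T0.
have u2 : u ^+ 2 <= A ^+ 2 by rewrite !expr2; apply: ler_pM.
have u20 : 0 <= u ^+ 2 by rewrite sqr_ge0.
have A20 : 0 <= A ^+ 2 by rewrite sqr_ge0.
have B20 : 0 <= B ^+ 2 by rewrite sqr_ge0.
have T20 : 0 <= T ^+ 2 by rewrite sqr_ge0.
have vv0 : 0 <= v * v' by apply: mulr_ge0.
have uu0 : 0 <= u * u' by apply: mulr_ge0.
have m1 : v * v' <= B ^+ 2 by rewrite expr2; apply: ler_pM.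
have m2 : u * u' <= A ^+ 2 by rewrite expr2; apply: ler_pM.
have m3 : u ^+ 2 * u' <= A ^+ 3 by rewrite [leRHS]exprSr; apply: ler_pM.
have uuu0 : 0 <= u ^+ 2 * u' by apply: mulr_ge0.
have m4 : u ^+ 2 * (v * v') <= A ^+ 2 * B ^+ 2 by apply: ler_pM.
have m5 : u ^+ 2 * u' * v <= A ^+ 3 * B by apply: ler_pM.
have m6 : 0 <= u ^+ 2 * u' * v' by apply: mulr_ge0.
have m7 := ler_wpM2l (ltW T0) m3.
have m8 := ler_wpM2l T20 m2.
have m9 := ler_wpM2l T20 m1.
have n1 : 0 <= T * (u ^+ 2 * u') by apply: mulr_ge0.
have n2 := mulr_ge0 A20 B20.
have n3 : 0 <= A ^+ 3 * B by apply: mulr_ge0 => //; apply: exprn_ge0.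
have n4 : 0 <= T * A ^+ 3 by apply: mulr_ge0 => //; apply: exprn_ge0.
have n5 := mulr_ge0 T20 A20.
have n6 := mulr_ge0 T20 B20.
set D := A ^+ 2 * B ^+ 2 + A ^+ 3 * B + T * A ^+ 3 + T ^+ 2 * A ^+ 2 + T ^+ 2 * B ^+ 2.
have pqh : 0 <= p * q * h by rewrite mulr_ge0// ltW.
have up : u * u' * v' - T * u * u' - T ^+ 2 * (u' + v) <= h * D.
  by rewrite eup; apply: ler_wpM2l => //; rewrite /D; lra.
have lo : - (h * D) <= u * u' * v - T * u * u' - T ^+ 2 * (u + v').
  by rewrite elo -mulrN; apply: ler_wpM2l => //; rewrite /D; lra.
have up' := ler_wpM2l pqh up.
have lo' := ler_wpM2l pqh lo.
have T2pq : 0 <= p * q * T ^+ 2 by rewrite mulr_ge0// ltW.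
have k1 := ler_wpM2l T2pq l1; have k2 := ler_wpM2l T2pq l2.
have k3 := ler_wpM2l T2pq l3; have k4 := ler_wpM2l T2pq l4.
rewrite eu in g1 g2; rewrite eu ler_norml; apply/andP; split; lra.
Qed.

Variables (d : measure_display) (Omega : measurableType d) (P : probability Omega R).
Variables X Y : Omega -> R.
Hypotheses (mX : measurable_fun setT X) (mY : measurable_fun setT Y).
Hypothesis XY : independent2 P X Y.

(** The integration runs over [Y], so [p] is [b] and [q] is [a] in the primitive. It covers
    [b < Y <= t - a]; beyond that, [X > a] almost surely already makes the sum exceed [t]. *)
Lemma tail_sum_pareto a b t : 0 < a -> 0 < b ->
  (forall x, a <= x -> survival P X x = a / x) ->
  (forall y, b <= y -> survival P Y y = b / y) ->
  a + b < t ->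
  survival P (X \+ Y) t = (a + b) / t + a * b / t ^+ 2 * ln ((t - a) * (t - b) / (a * b)).
Proof.
move=> a0 b0 HX HY abt.
have t0 : 0 < t by lra.
pose G s := prob P [set o | t < X o + Y o /\ Y o <= s].
have mXY : measurable_fun setT (X \+ Y) by exact: measurable_funD.
have incr : G (t - a) - pareto_primitive b a t (t - a) = G b - pareto_primitive b a t b.
  have [|C HC] := @pareto_primitive_increment b a t b0 a0; first by lra.
  apply: esym; apply: (@quadratic_increments_const
    (fun s => G s - pareto_primitive b a t s) b (t - a) C); first by lra.
  move=> s s' bs ss' s't.
  have -> : G s' - pareto_primitive b a t s' - (G s - pareto_primitive b a t s) =
    (G s' - G s) - (pareto_primitive b a t s' - pareto_primitive b a t s) by ring.
  have eG : G s' - G s = prob P [set o | t < X o + Y o /\ s < Y o <= s'].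
    by rewrite /G (pr_sum_gt_step P mX mY t ss') addrAC subrr add0r.
  have bs' : b <= s' by lra.
  rewrite eG; apply: HC => //.
    rewrite -!HY// -HX; last by lra.
    rewrite -(pr_gt_itv mX mY XY)//; apply: le_pr.
    - exact: measurable_gt_itv.
    - exact: measurable_sum_gt_itv.
    - by move=> o /= [? /andP[? ?]]; split; [lra|apply/andP].
  rewrite -!HY// -HX; last by lra.
  rewrite -(pr_gt_itv mX mY XY)//; apply: le_pr.
  - exact: measurable_sum_gt_itv.
  - exact: measurable_gt_itv.
  - by move=> o /= [? /andP[? ?]]; split; [lra|apply/andP].
(* The tail of [Y] at [b] is 1, so [Y <= b] is null; this fixes the constant of integration. *)
have Gb : G b = 0.
  apply: (@pr_subset0 _ _ _ _ _ [set o | Y o <= b]).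
  - exact: measurable_sum_gt_le.
  - exact: measurable_le.
  - by move=> o [].
  - by rewrite pr_le_tail// HY// divff ?gt_eqF// subrr.
have mle : measurable [set o | Y o <= t - a] by exact: measurable_le.
have mgt : measurable [set o | t < (X \+ Y) o] by exact: measurable_gt.
have mgtY : measurable [set o | t - a < Y o] by exact: measurable_gt.
have big : prob P ([set o | t < (X \+ Y) o] `&` ~` [set o | Y o <= t - a]) = b / (t - a).
  rewrite -HY; last by lra.
  have -> : ~` [set o | Y o <= t - a] = [set o | t - a < Y o].
    by apply/seteqP; split => o /=; rewrite ltNge => /negP.
  apply/eqP; rewrite eq_le; apply/andP; split.
    by apply: le_pr => //; exact: measurableI.
  have mXa : measurable [set o | X o <= a] by exact: measurable_le.
  have Xa : prob P [set o | X o <= a] = 0 by rewrite pr_le_tail// HX// divff ?gt_eqF// subrr.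
  rewrite -[leRHS]addr0 -Xa; apply: le_trans (prU_le P (measurableI _ _ mgt mgtY) mXa).
  apply: le_pr => //; first by apply: measurableU => //; exact: measurableI.
  move=> o /= h; case: (leP (X o) a) => hX; first by right.
  by left; split => //=; lra.
rewrite /survival (pr_split P mgt mle) big.
have -> : prob P ([set o | t < (X \+ Y) o] `&` [set o | Y o <= t - a]) = G (t - a) by [].
have -> : G (t - a) = pareto_primitive b a t (t - a) - pareto_primitive b a t b.
  by rewrite -(subrK (pareto_primitive b a t (t - a)) (G (t - a))) incr Gb; ring.
have ta : 0 < t - a by lra.
have tb : 0 < t - b by lra.
rewrite lnM ?posrE ?invr_gt0 ?mulr_gt0// lnV ?posrE ?mulr_gt0// !lnM ?posrE//.
have taa : t - (t - a) = a by ring.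
rewrite /pareto_primitive taa; field; rewrite !gt_eqF//.
Qed.

End exact_identity.

(** * The two marginal laws *)

Section marginals.
Variables (R : realType) (d : measure_display) (Omega : measurableType d).
Variable P : probability Omega R.

Lemma ccdf_tail (X : {RV P >-> R}) y : ccdf X y = (survival P X y)%:E.
Proof.
rewrite /survival -prE; last exact: measurable_gt (measurable_funPT X).
congr (P _); apply/seteqP; split => o; by rewrite /= in_itv/= andbT.
Qed.

Lemma pareto_tail (Y : {RV P >-> R}) y : standard_pareto Y -> 1 <= y ->
  survival P Y y = y^-1.
Proof. by move=> HY y1; have := HY y y1; rewrite ccdf_tail; case. Qed.

Lemma pareto_lt0 (Y : {RV P >-> R}) : standard_pareto Y -> prob P [set o | Y o < 0] = 0.
Proof.
move=> HY; have mY : measurable_fun setT Y by exact: measurable_funPT.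
apply: (@pr_subset0 _ _ _ _ _ [set o | Y o <= 1]).
- exact: measurable_lt.
- exact: measurable_le.
- by move=> o /=; lra.
- by rewrite pr_le_tail// pareto_tail// invr1 subrr.
Qed.

Lemma pareto_tail_expansion (Y : {RV P >-> R}) : standard_pareto Y ->
  tail_expansion 1 0 (survival P Y).
Proof.
move=> HY; exists 0 => // x x1.
by rewrite pareto_tail// mul0r addr0 div1r subrr normr0 mul0r.
Qed.

Lemma pareto_scaled_tail (Y : {RV P >-> R}) w x : standard_pareto Y -> 0 < w ->
  w <= x -> survival P (fun o => w * Y o) x = w / x.
Proof.
move=> HY w0 wx; have <- : survival P Y (x / w) = w / x.
  by rewrite pareto_tail ?invf_div// ler_pdivlMr// mul1r.
by congr (prob _); apply/seteqP; split => o /=; rewrite ltr_pdivrMr// mulrC.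
Qed.

Lemma half_cauchy_tail (H : {RV P >-> R}) x : standard_half_cauchy H -> 0 < x ->
  survival P H x = 2 / pi * atan (1 / x).
Proof. by move=> HH x0; have := HH x x0; rewrite ccdf_tail; case. Qed.

(** The tail is prescribed only for [x > 0] but tends to 1 at 0, so any positive mass below 0 is
    contradicted at some small positive point. *)
Lemma half_cauchy_lt0 (H : {RV P >-> R}) : standard_half_cauchy H ->
  prob P [set o | H o < 0] = 0.
Proof.
move=> HH; have mH : measurable_fun setT H by exact: measurable_funPT.
have p0 := pi_gt0 R.
apply/eqP; rewrite eq_le pr_ge0 andbT leNgt; apply/negP => e0.
pose e := Num.min (prob P [set o | H o < 0]) 1 / 2.
have e00 : 0 < e by rewrite divr_gt0// lt_min e0 ltr01.
have e1 : e < 1.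
  by rewrite ltr_pdivrMr// mul1r gt_min; apply/orP; right; lra.
have ep : e < prob P [set o | H o < 0].
  by rewrite ltr_pdivrMr// gt_min; apply/orP; left; lra.
(* The tail at [y^-1] is then exactly [1 - e], so [H <= y^-1] has probability [e], less than the
   supposed mass. *)
pose y := tan (pi / 2 * (1 - e)).
have he : 0 < pi / 2 * (1 - e) by rewrite mulr_gt0 ?divr_gt0// subr_gt0.
have he2 : pi / 2 * (1 - e) < pi / 2.
  by rewrite gtr_pMr ?divr_gt0//; lra.
have hy : atan y = pi / 2 * (1 - e).
  by rewrite tanK// in_itv/=; apply/andP; split => //; lra.
have y0 : 0 < y by rewrite ltNge; apply/negP => /le_atan; rewrite atan0 hy; lra.
have x0 : 0 < y^-1 by rewrite invr_gt0.
have : prob P [set o | H o < 0] <= prob P [set o | H o <= y^-1].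
  apply: le_pr; [exact: measurable_lt|exact: measurable_le|].
  by move=> o /= h; exact/ltW/(lt_trans h).
rewrite pr_le_tail// half_cauchy_tail// div1r invrK hy.
rewrite mulrA mulr_pihalf mul1r; lra.
Qed.

(** By the mean value theorem [atan u = u / (1 + c ^+ 2)] with [0 <= c <= u], and
    [1 - u ^+ 2 <= 1 / (1 + c ^+ 2) <= 1]. *)
Lemma atan_le_id_cubic (u : R) : 0 <= u -> u - u ^+ 3 <= atan u <= u.
Proof.
move=> u0.
have [|c] := @MVT_segment R atan (fun x => (1 + x ^+ 2)^-1) 0 u u0.
  by apply: continuous_subspaceT => x; exact: continuous_atan.
rewrite in_itv/= atan0 !subr0 => /andP[c0 cu] ->.
have c2 : 0 <= c ^+ 2 by rewrite sqr_ge0.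
have c20 : 0 < 1 + c ^+ 2 by lra.
have cu2 : c ^+ 2 <= u ^+ 2 by rewrite lerXn2r.
apply/andP; split.
  have -> : u - u ^+ 3 = (1 - u ^+ 2) * u by ring.
  apply: ler_wpM2r => //; rewrite -[leRHS]mul1r ler_pdivlMr//.
  have := mulr_ge0 (sqr_ge0 u) c2; lra.
by rewrite ler_piMl// invf_le1//; lra.
Qed.

Lemma half_cauchy_tail_expansion (H : {RV P >-> R}) : standard_half_cauchy H ->
  tail_expansion (2 / pi) 0 (survival P H).
Proof.
move=> HH; have p0 := pi_gt0 R.
have c0 : 0 <= 2 / pi :> R by rewrite divr_ge0// ltW.
exists (2 / pi) => // x x1.
have x0 : 0 < x by lra.
have v0 : 0 <= x^-1 by rewrite invr_ge0 ltW.
have v1 : x^-1 <= 1 by rewrite invf_le1.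
rewrite half_cauchy_tail// mul0r addr0 div1r -mulrBr normrM (ger0_norm c0) -exprVn.
apply: ler_wpM2l => //.
have /andP[h1 h2] := atan_le_id_cubic v0.
have v3 : x^-1 ^+ 3 <= x^-1 ^+ 2 by rewrite exprSr ler_piMr// sqr_ge0.
by rewrite ler_norml; apply/andP; split; lra.
Qed.

End marginals.

(** * Assembly of the expansions, identities and counterexamples *)

Lemma sum_lt_ord_gt0 (R : numDomainType) (q : R) : 0 < q ->
  0 < \sum_(i < 2) \sum_(j < 2 | (i < j)%N) q.
Proof.
move=> q0; rewrite (bigD1 ord0)//= (bigD1 ord_max)//= -addrA ltr_pwDl//.
rewrite addr_ge0 ?sumr_ge0// => [? _|? _]; first exact: ltW.
by apply: sumr_ge0 => ? _; exact: ltW.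
Qed.

Theorem mainTheorem2 (R : realType) :
  (* Pareto expansion *)
  (forall (m : nat) (w : 'I_m -> R) (d : measure_display)
      (Omega : measurableType d) (P : probability Omega R)
      (Y : 'I_m -> {RV P >-> R}),
    (1 <= m)%N -> simplex_weights w ->
    independent_RVs Y -> (forall i, standard_pareto (Y i)) ->
    (fun t : R => fine (P [set omega | t < \sum_(i < m) w i * Y i omega])) =
    (fun t : R => 1 / t + 2 * (\sum_(i < m) \sum_(j < m | (i < j)%N) w i * w j)
                          * (ln t / t ^+ 2))
    +O_ (+oo%R) (fun t : R => t ^- 2)) /\
  (* exact identity for two positive weights *)
  (forall (w : 'I_2 -> R) (d : measure_display)
      (Omega : measurableType d) (P : probability Omega R)
      (Y : 'I_2 -> {RV P >-> R}),
    simplex_weights w ->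
    independent_RVs Y -> (forall i, standard_pareto (Y i)) ->
    let w1 := w ord0 in let w2 := w ord_max in
    let Y1 := Y ord0 in let Y2 := Y ord_max in
    0 < w1 -> 0 < w2 ->
    forall t : R, w1 + w2 < t ->
      P [set omega | t < w1 * Y1 omega + w2 * Y2 omega] =
      ((w1 + w2) / t
       + w1 * w2 / t ^+ 2 * ln ((t - w1) * (t - w2) / (w1 * w2)))%:E) /\
  (* exact identity when one of the two weights, w i, is zero *)
  (forall (w : 'I_2 -> R) (d : measure_display)
      (Omega : measurableType d) (P : probability Omega R)
      (Y : 'I_2 -> {RV P >-> R}),
    simplex_weights w ->
    independent_RVs Y -> (forall i, standard_pareto (Y i)) ->
    forall i j : 'I_2, i != j -> w i = 0 ->
    forall t : R, w j <= t ->
      P [set omega | t < w ord0 * Y ord0 omega + w ord_max * Y ord_max omega] =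
      (w j / t)%:E) /\
  (* Half-Cauchy expansion *)
  (forall (m : nat) (w : 'I_m -> R) (d : measure_display)
      (Omega : measurableType d) (P : probability Omega R)
      (H : 'I_m -> {RV P >-> R}),
    (1 <= m)%N -> simplex_weights w ->
    independent_RVs H -> (forall i, standard_half_cauchy (H i)) ->
    let c : R := 2 / pi in
    (fun t : R => fine (P [set omega | t < \sum_(i < m) w i * H i omega])) =
    (fun t : R => c / t
       + 2 * c ^+ 2 * (\sum_(i < m) \sum_(j < m | (i < j)%N) w i * w j)
         * (ln t / t ^+ 2))
    +O_ (+oo%R) (fun t : R => t ^- 2)) /\
  (* the Pareto correction is not O(t^-2) for all m and all w *)
  ~ (forall (m : nat) (w : 'I_m -> R) (d : measure_display)
      (Omega : measurableType d) (P : probability Omega R)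
      (Y : 'I_m -> {RV P >-> R}),
    (1 <= m)%N -> simplex_weights w ->
    independent_RVs Y -> (forall i, standard_pareto (Y i)) ->
    (fun t : R => fine (P [set omega | t < \sum_(i < m) w i * Y i omega])) =
    (fun t : R => 1 / t) +O_ (+oo%R) (fun t : R => t ^- 2)) /\
  (* the Half-Cauchy correction is not O(t^-2) for all m and all w *)
  ~ (forall (m : nat) (w : 'I_m -> R) (d : measure_display)
      (Omega : measurableType d) (P : probability Omega R)
      (H : 'I_m -> {RV P >-> R}),
    (1 <= m)%N -> simplex_weights w ->
    independent_RVs H -> (forall i, standard_half_cauchy (H i)) ->
    let c : R := 2 / pi in
    (fun t : R => fine (P [set omega | t < \sum_(i < m) w i * H i omega])) =
    (fun t : R => c / t) +O_ (+oo%R) (fun t : R => t ^- 2)).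
Proof.
(* Equal weights on two variables refute both improved rates, since their cross sum is positive. *)
have half : simplex_weights (fun _ : 'I_2 => 2^-1 : R).
  by split=> // ; rewrite !big_ord_recl big_ord0 addr0; lra.
have half0 : 0 < \sum_(i < 2) \sum_(j < 2 | (i < j)%N) (2^-1 * 2^-1 : R).
  by apply: sum_lt_ord_gt0; rewrite mulr_gt0// invr_gt0.
have c0 : 0 < 2 / pi :> R by rewrite divr_gt0// pi_gt0.
have pareto m (w : 'I_m -> R) d (T : measurableType d) (P : probability T R)
    (Y : 'I_m -> {RV P >-> R}) : simplex_weights w -> independent_RVs Y ->
    (forall i, standard_pareto (Y i)) ->
    tail_expansion 1 (2 * (\sum_(i < m) \sum_(j < m | (i < j)%N) w i * w j))
      (fun t => fine (P [set o | t < \sum_(i < m) w i * Y i o])).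
  move=> hw indY HY; rewrite -[2]mulr1 -[X in 2 * X](expr1n _ 2).
  apply: tail_expansion_simplex => // i.
  - exact: pareto_tail_expansion.
  - exact: pareto_lt0.
have cauchy m (w : 'I_m -> R) d (T : measurableType d) (P : probability T R)
    (H : 'I_m -> {RV P >-> R}) : simplex_weights w -> independent_RVs H ->
    (forall i, standard_half_cauchy (H i)) ->
    tail_expansion (2 / pi)
      (2 * (2 / pi) ^+ 2 * (\sum_(i < m) \sum_(j < m | (i < j)%N) w i * w j))
      (fun t => fine (P [set o | t < \sum_(i < m) w i * H i o])).
  move=> hw indH HH; apply: tail_expansion_simplex => // [|i|i].
  - exact: ltW.
  - exact: half_cauchy_tail_expansion.
  - exact: half_cauchy_lt0.
split; [|split; [|split; [|split; [|split]]]].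
- move=> m w d T P Y _ hw indY HY.
  exact: tail_expansion_bigO (pareto _ _ _ _ _ _ hw indY HY).
- move=> w d T P Y hw indY HY /= w10 w20 t ht.
  have mY i : measurable_fun setT (fun o => w i * Y i o).
    by apply: measurable_funM => //; exact: measurable_funPT.
  have ind : independent2 P (fun o => w ord0 * Y ord0 o) (fun o => w ord_max * Y ord_max o).
    (* The second summand is viewed as a one-term combination, so that [independent_lin_comb]
       applies. *)
    apply: independent2_scale; rewrite (_ : (fun o => w ord_max * _) =
      (fun o => \sum_(j <- [:: ord_max]) w j * Y j o)).
      exact: independent_lin_comb.
    by apply/funext => o; rewrite big_seq1.
  rewrite prE; last first.
    by apply: measurable_gt; exact: measurable_funD.
  congr EFin; apply: (tail_sum_pareto (mY _) (mY _) ind) => // x wx;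
    exact: pareto_scaled_tail.
- move=> w d T P Y [w0 w1] indY HY i j ij wi t wjt.
  have sumE (F : 'I_2 -> R) : F ord0 + F ord_max = F i + F j.
    have e (k : 'I_2) : k = ord0 \/ k = ord_max.
      by case: k => [[|[|//]]] p; [left|right]; exact/val_inj.
    by case: (e i) ij => ->; case: (e j) => ->; rewrite ?eqxx// addrC.
  have wj : w j = 1.
    move: w1; rewrite big_ord_recl big_ord1.
    rewrite (_ : lift ord0 ord0 = ord_max) ?sumE ?wi ?add0r//; exact/val_inj.
  rewrite wj in wjt *.
  rewrite div1r -(HY j t wjt) ccdf_tail /survival -prE; last first.
    exact: measurable_gt (measurable_funPT _).
  congr (P _); apply/seteqP; split => o /=;
    by rewrite (sumE (fun k => w k * Y k o)) wi wj mul0r add0r mul1r.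
- move=> m w d T P H _ hw indH HH c.
  exact: tail_expansion_bigO (cauchy _ _ _ _ _ _ hw indH HH).
- move=> contra; have [d [T [P [Y [indY HY]]]]] := exists_pareto_pair R.
  apply: (tail_expansion_not_bigO _ (pareto _ _ _ _ _ _ half indY HY)).
    by rewrite mulr_gt0.
  exact: contra.
- move=> contra; have [d [T [P [H [indH HH]]]]] := exists_half_cauchy_pair R.
  apply: (tail_expansion_not_bigO _ (cauchy _ _ _ _ _ _ half indH HH)).
    by rewrite mulr_gt0// mulr_gt0// exprn_gt0.
  exact: contra.
Qed.
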